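(* Let $N$ be an odd positive integer such that $\mathfrak{R}(N)$ is a Burnside number. Let $k_1,l_1,k_2,l_2$ be positive integers with $k_1l_1=k_2l_2=N$ and $(k_1,l_1)=(k_2,l_2)=1$, and put $\Gamma=\mathfrak{M}_{k_1,l_1}$ and $G=\mathfrak{M}_{k_2,l_2}$. Let $K/F$ be a Galois extension of fields with $\mathrm{Gal}(K/F)\cong\Gamma$. Then the number $e(\Gamma,G)$ of Hopf-Galois structures on $K/F$ of type $G$ is $$e(\Gamma,G)=\frac{l_1l_2}{(l_1,l_2)\,\mathfrak{R}(l_1)}\cdot 2^{|\pi(k_2)|}.$$
   Context: Notation: $(a,b)$ is the greatest common divisor of $a,b$. For $n\in\mathbb{N}$, $\pi(n)$ is the set of primes dividing $n$, $\mathfrak{R}(n)=\prod_{p\in\pi(n)}p$ is the radical of $n$ (so $\mathfrak{R}(1)=1$), and $\varphi$ is Euler's totient function. A number $n\in\mathbb{N}$ is a Burnside number if $(n,\varphi(n))=1$. For positive integers $k,l$ with $kl=N$ odd and $(k,l)=1$, $\mathfrak{M}_{k,l}=D_{2k}\times C_l$, where $D_{2k}=\langle r,s : r^k=s^2=1,\ srs=r^{-1}\rangle$ is the dihedral group of order $2k$ (so $D_2\cong C_2$ when $k=1$) and $C_l$ is the cyclic group of order $l$. A Hopf-Galois structure on a finite separable extension $K/F$ is an $F$-Hopf algebra $H$ with an action on $K$ making $K$ an $H$-module algebra such that the map $j:K\otimes_F H\to \mathrm{End}_F(K)$, $j(s\otimes h)(s')=s\,h(s')$, is an isomorphism. When $K/F$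 is Galois with group $\Gamma$, Hopf-Galois structures on $K/F$ correspond bijectively (Greither-Pareigis) to regular subgroups of $\mathrm{Perm}(\Gamma)$ (the group of permutations of the set $\Gamma$) normalized by $\lambda(\Gamma)$, where $\lambda$ is the left regular representation; the subgroup $M$ corresponds to the Hopf algebra $K[M]^\Gamma$. The type of the structure is the isomorphism class of the corresponding regular subgroup. Thus $e(\Gamma,G)$ is the number of regular subgroups of $\mathrm{Perm}(\Gamma)$ that are isomorphic to $G$ and normalized by $\lambda(\Gamma)$, i.e. the number of Hopf-Galois structures on $K/F$ of type $G$. *)

(* Defs.v *)
From HB Require Import structures.
From mathcomp Require Import all_boot all_order all_algebra all_fingroup.
From mathcomp Require Import all_solvable all_field.

Set Implicit Arguments.
Unset Strict Implicit.
Unset Printing Implicit Defensive.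

Import GRing.Theory.
Local Open Scope ring_scope.

(** * Arithmetic *)

Definition radical (n : nat) : nat := (\prod_(p <- primes n) p)%N.

Definition burnside_number (n : nat) : bool := coprime n (totient n).

(** * The groups M_(k,l) = D_(2k) x C_l *)

(* D is given by its presentation because MathComp's 'D_m requires m >= 4,
   whereas k = 1 is needed here (then D has order 2). *)
Definition is_Mgroup (k l : nat) (gT : finGroupType) (G : {set gT}) : Prop :=
  exists D C : {group gT},
    [/\ (D \x C = G)%g,
        (D \isog Grp (r : s : r ^+ k, s ^+ 2, s * r * s = r^-1))%g,
        cyclic C
      & #|C| = l].

(** * Regular subgroups and the number e(Gamma, G) *)

Definition regular_subgroup (T : finType) (M : {set {perm T}}) : bool :=
  [transitive M, on [set: T] | 'P] && [forall x : T, 'C_M[x | 'P]%g == 1%g].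

Definition left_mul (gT : finGroupType) (g : gT) : {perm gT} := perm (mulgI g).

Definition e_number (gammaT gT : finGroupType) (G : {set gT}) : nat :=
  #|[set M : {group {perm gammaT}} |
      [&& regular_subgroup M,
          [set left_mul g | g in [set: gammaT]] \subset 'N(M)%g
        & M \isog G]]|.

(** * Tensors *)

(* An element of the tensor product of V and W over F is written as a finite
   sum of pure tensors, i.e. as a sequence of pairs (v, w).  By the universal
   property, two sums are equal in the tensor product iff every bilinear map
   takes the same value on them; likewise for triple tensors. *)
Definition bilinear_map (F : fieldType) (V W U : lmodType F)
    (B : V -> W -> U) : Prop :=
  (forall w, linear (B ^~ w)) /\ (forall v, linear (B v)).

Definition trilinear_map (F : fieldType) (V W X U : lmodType F)
    (B : V -> W -> X -> U) : Prop :=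
  [/\ forall w x, linear (fun v => B v w x),
      forall v x, linear (fun w => B v w x)
    & forall v w, linear (B v w)].

Definition tensor_eq (F : fieldType) (V W : lmodType F)
    (s t : seq (V * W)) : Prop :=
  forall (U : lmodType F) (B : V -> W -> U), bilinear_map B ->
    \sum_(p <- s) B p.1 p.2 = \sum_(p <- t) B p.1 p.2.

Definition tensor3_eq (F : fieldType) (V W X : lmodType F)
    (s t : seq (V * W * X)) : Prop :=
  forall (U : lmodType F) (B : V -> W -> X -> U), trilinear_map B ->
    \sum_(p <- s) B p.1.1 p.1.2 p.2 = \sum_(p <- t) B p.1.1 p.1.2 p.2.

(** * Hopf algebras *)

(* [comul h] is a choice of Sweedler representative of Delta(h). *)
Record is_hopf_algebra (F : fieldType) (H : algType F)
    (comul : H -> seq (H * H)) (counit : H -> F) (antipode : H -> H) : Prop :=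
  IsHopfAlgebra {
    comul_linear : forall (a : F) (g h : H),
      tensor_eq (comul (a *: g + h))
                ([seq (a *: p.1, p.2) | p <- comul g] ++ comul h);
    comul_one : tensor_eq (comul 1) [:: (1, 1)];
    comul_mul : forall g h : H,
      tensor_eq (comul (g * h))
                [seq (p.1 * q.1, p.2 * q.2) | p <- comul g, q <- comul h];
    counit_linear : scalar counit;
    counit_one : counit 1 = 1;
    counit_mul : forall g h : H, counit (g * h) = counit g * counit h;
    comul_assoc : forall h : H,
      tensor3_eq [seq (q.1, q.2, p.2) | p <- comul h, q <- comul p.1]
                 [seq (p.1, q.1, q.2) | p <- comul h, q <- comul p.2];
    comul_counitl : forall h : H, \sum_(p <- comul h) counit p.1 *: p.2 = h;
    comul_counitr : forall h : H, \sum_(p <- comul h) counit p.2 *: p.1 = h;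
    antipode_linear : linear antipode;
    antipodel : forall h : H,
      \sum_(p <- comul h) antipode p.1 * p.2 = (counit h)%:A;
    antipoder : forall h : H,
      \sum_(p <- comul h) p.1 * antipode p.2 = (counit h)%:A
  }.

(** * Hopf-Galois structures on an extension L of its base field F *)

Record is_module_algebra (F : fieldType) (L : fieldExtType F) (H : algType F)
    (comul : H -> seq (H * H)) (counit : H -> F) (act : H -> L -> L) : Prop :=
  IsModuleAlgebra {
    act_linearl : forall x : L, linear (act ^~ x);
    act_linearr : forall h : H, linear (act h);
    act_one : forall x : L, act 1 x = x;
    act_mul : forall (g h : H) (x : L), act (g * h) x = act g (act h x);
    act_alg_one : forall h : H, act h 1 = (counit h)%:A;
    act_alg_mul : forall (h : H) (x y : L),
      act h (x * y) = \sum_(p <- comul h) act p.1 x * act p.2 y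
  }.

Definition galois_map (F : fieldType) (L : fieldExtType F) (H : algType F)
    (act : H -> L -> L) (t : seq (L * H)) (x : L) : L :=
  \sum_(p <- t) p.1 * act p.2 x.

Definition galois_map_bijective (F : fieldType) (L : fieldExtType F)
    (H : algType F) (act : H -> L -> L) : Prop :=
  (forall s t : seq (L * H),
     galois_map act s =1 galois_map act t -> tensor_eq s t) /\
  (forall T : 'End(L), exists t : seq (L * H), galois_map act t =1 T).

Record hopf_galois (F : fieldType) (L : fieldExtType F) := HopfGalois {
  hg_alg : algType F;
  hg_comul : hg_alg -> seq (hg_alg * hg_alg);
  hg_counit : hg_alg -> F;
  hg_antipode : hg_alg -> hg_alg;
  hg_act : hg_alg -> L -> L;
  hg_hopf : is_hopf_algebra hg_comul hg_counit hg_antipode;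
  hg_module_algebra : is_module_algebra hg_comul hg_counit hg_act;
  hg_galois : galois_map_bijective hg_act
}.

Definition hopf_galois_iso (F : fieldType) (L : fieldExtType F)
    (S1 S2 : hopf_galois L) : Prop :=
  exists f : hg_alg S1 -> hg_alg S2,
    [/\ bijective f /\ linear f,
        f 1 = 1 /\ {morph f : g h / g * h},
        forall h, tensor_eq [seq (f p.1, f p.2) | p <- hg_comul h]
                            (hg_comul (f h)),
        (forall h, hg_counit (f h) = hg_counit h) /\
        (forall h, f (hg_antipode h) = hg_antipode (f h))
      & forall h x, hg_act (f h) x = hg_act h x].

(** * The Greither-Pareigis correspondence *)

(* MathComp composes both Galois automorphisms and permutations from left to
   right: (x * y) a = y (x a).  In this section, the product x y of the
   mathematical convention (x after y) is therefore written y * x. *)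

(* Left translation d |-> g o d. *)
Definition gal_lambda (F : fieldType) (L : splittingFieldType F)
    (g : gal_of {:L}) : {perm gal_of {:L}} := perm (mulIg g).

(* K[M] is the set of functions c supported on M, c standing for
   \sum_m c_m m; Gamma acts by the Galois action on coefficients and by
   m |-> lambda(g) m lambda(g)^-1, that is m ^ lambda(g), on M. *)
Definition fixed_group_algebra (F : fieldType) (L : splittingFieldType F)
    (M : {set {perm gal_of {:L}}}) (c : {ffun {perm gal_of {:L}} -> L}) : Prop :=
  (forall m, m \notin M -> c m = 0) /\
  (forall (g : gal_of {:L}) m, m \in M -> c (m ^ gal_lambda g)%g = g (c m)).

(* f is an isomorphism of Hopf algebras from H to K[M]^Gamma, compatible with
   the actions on K, where \sum_m c_m m acts by
   x |-> \sum_m c_m (m^-1 (1_Gamma)) (x). *)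
Record is_GP_iso (F : fieldType) (L : splittingFieldType F)
    (M : {set {perm gal_of {:L}}}) (S : hopf_galois L)
    (f : hg_alg S -> {ffun {perm gal_of {:L}} -> L}) : Prop := IsGPIso {
  GP_linear : linear f;
  GP_inj : injective f;
  GP_image : forall c, fixed_group_algebra M c <-> exists h, f h = c;
  GP_one : forall m, f 1 m = (m == 1%g)%:R;
  GP_mul : forall g h m,
    f (g * h) m = \sum_(n in M) f g n * f h (m * n^-1)%g;
  GP_comul : forall h m n,
    \sum_(p <- hg_comul h) f p.1 m * f p.2 n = if m == n then f h m else 0;
  GP_counit : forall h, (hg_counit h)%:A = \sum_(m in M) f h m;
  GP_antipode : forall h m, f (hg_antipode h) m = f h m^-1%g;
  GP_act : forall h x,
    hg_act h x = \sum_(m in M) f h m * ((m^-1)%g (1%g : gal_of {:L})) x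
}.

(* M corresponds to S. *)
Definition GP_corresponds (F : fieldType) (L : splittingFieldType F)
    (M : {group {perm gal_of {:L}}}) (S : hopf_galois L) : Prop :=
  [/\ regular_subgroup M,
      [set gal_lambda g | g in 'Gal({:L} / 1)%g] \subset 'N(M)%g
    & exists f, is_GP_iso M (S := S) f].

Definition has_type (F : fieldType) (L : splittingFieldType F)
    (gT : finGroupType) (G : {set gT}) (S : hopf_galois L) : Prop :=
  exists2 M : {group {perm gal_of {:L}}}, GP_corresponds M S & M \isog G.

(* There are exactly n Hopf-Galois structures of type G on L, up to
   isomorphism. *)
Definition num_hopf_galois_of_type (F : fieldType) (L : splittingFieldType F)
    (gT : finGroupType) (G : {set gT}) (n : nat) : Prop :=
  exists S : 'I_n -> hopf_galois L,
    [/\ forall i, has_type G (S i),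
        forall i j, hopf_galois_iso (S i) (S j) -> i = j
      & forall S', has_type G S' -> exists i, hopf_galois_iso S' (S i)].

(* Main.v *)
Require Import Defs.
From HB Require Import structures.
From mathcomp Require Import all_boot all_order all_algebra all_fingroup.
From mathcomp Require Import all_solvable all_field.
From mathcomp Require Import ring.

Set Implicit Arguments.
Unset Strict Implicit.
Unset Printing Implicit Defensive.

Import GRing.Theory.
Local Open Scope ring_scope.

(** The number of Hopf-Galois structures is a number of regular permutation
    groups, and that number can be computed with affine maps modulo N.

    Hopf-Galois structures. For a regular group M of permutations of the Galois
    group that is normalised by the left translations, the functions from M to
    L that are fixed by the Galois action form a Hopf algebra over F.  Galois
    descent (fixed_algebra_span, fixed_algebra_dual_bases) says that the fixed
    functions span all functions over L; hence an identity between tensors over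
    F can be checked by evaluating at elements of M (tensor_eq_fa), and
    every Hopf axiom becomes an identity between functions on M.  The Galois map
    is bijective because the Galois automorphisms are linearly independent and
    span End(L).  Conversely the action determines, by independence of
    characters, the value of a fixed function at each m in M in terms of the
    automorphism to which m corresponds, and the product then determines M
    itself (GP_corresponds_sub).  So the structures of type G correspond to the
    regular M isomorphic to G, and as isomorphic regular groups are conjugate
    by a bijection of the underlying sets, their number is e(Gamma, G)
    (num_hopf_galois_e_number).

    Reduction to affine maps. For N > 1 the group D_(2k) x C_l is isomorphic to
    the group L_w of the permutations (x, s) |-> (w^t x + c, t + s) of Z/N x Z/2,
    where w is -1 modulo k and 1 modulo l (Mgroup_isog).  Let u and v be the
    units w for Gamma and G.  The regular groups M to be counted are the
    conjugates of L_v normalised by L_u, so that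
      e(Gamma, G) * (order of the stabiliser of the origin in N(L_v))
        = number of q fixing the origin with L_u ^ q inside N(L_v)
    (num_regular_normalizer).  The normaliser N(L_v) consists of the maps
    (x, s) |-> (a x + c_s, t + s) with a unit a and (1 + v)(c_1 - c_0) = 0
    (norm_dihedralP).

    The parameters. The permutation q is determined by the images of the two
    generators of L_u, that is by the maps z |-> (1 + nu) z + c on the first
    fibre and z |-> g z + d from the first fibre to the second.  The first must
    be an N-cycle: c is a unit and nu is divisible by every prime divisor of N.
    That this suffices is the fact that the geometric sum 1 + a + ... + a^(m-1)
    with a = 1 + nu is m times a unit when N is odd (geo_lift).  The
    relations of L_u and the shape of N(L_v) amount to the equations
      (u - 1) nu = 0,  g^2 = 1,  (1 + v)(g - u) = 0,  (1 + u)(1 + v) d = 0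
    (frame_param, frame_fun_norm, frame_exists).  These are independent, with
    l1 / rad(l1) choices of nu, 2^(number of primes dividing k2) choices of g
    and N / gcd(l1, l2) choices of d; the choices of c cancel against the units
    a of the stabiliser, and the k2 choices of c_1 in the stabiliser remain as
    the number by which the product is divided. *)

(** * The opposite group algebra *)

Section GroupAlgebra.
Variables (F : fieldType) (L : fieldExtType F) (gT : finGroupType).

(** Functions on gT with values in L, under the convolution in which the point
    masses at x and y multiply to the point mass at y * x: permutations compose
    from left to right, whereas the convolution follows the usual convention. *)
Definition opp_group_algebra := {ffun gT -> L}.

HB.instance Definition _ :=
  GRing.Lmodule.copy opp_group_algebra {ffun gT -> L}.

Implicit Types a b c : opp_group_algebra.

Definition ga_one : opp_group_algebra := [ffun m => (m == 1%g)%:R].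
Definition ga_mul a b : opp_group_algebra :=
  [ffun m => \sum_n a n * b (m * n^-1)%g].

Fact ga_mulA : associative ga_mul.
Proof.
move=> a b c; apply/ffunP=> m; rewrite !ffunE.
under eq_bigr do rewrite ffunE mulr_sumr.
under [RHS]eq_bigr do rewrite ffunE mulr_suml.
rewrite [RHS]exchange_big /=; apply: eq_bigr => k _.
rewrite [RHS](reindex_inj (mulIg k)) /=; apply: eq_bigr => j _.
by rewrite mulrA mulgK invMg mulgA.
Qed.

Fact ga_mul1 : left_id ga_one ga_mul.
Proof.
move=> a; apply/ffunP=> m; rewrite ffunE (bigD1 1%g) //= ffunE eqxx mul1r.
rewrite invg1 mulg1 big1 ?addr0 // => n /negPf n1.
by rewrite ffunE n1 mul0r.
Qed.

Fact ga_mulr1 : right_id ga_one ga_mul.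
Proof.
move=> a; apply/ffunP=> m; rewrite ffunE (bigD1 m) //= ffunE mulgV eqxx mulr1.
rewrite big1 ?addr0 // => n /negPf nm; rewrite ffunE -eq_mulgV1 eq_sym nm.
by rewrite mulr0.
Qed.

Fact ga_mulDl : left_distributive ga_mul +%R.
Proof.
move=> a b c; apply/ffunP=> m; rewrite !ffunE -big_split.
by apply: eq_bigr => n _; rewrite ffunE mulrDl.
Qed.

Fact ga_mulDr : right_distributive ga_mul +%R.
Proof.
move=> a b c; apply/ffunP=> m; rewrite !ffunE -big_split.
by apply: eq_bigr => n _; rewrite ffunE mulrDr.
Qed.

Fact ga_one_neq0 : ga_one != 0.
Proof.
apply/eqP=> /ffunP/(_ 1%g); rewrite !ffunE eqxx => /eqP.
by rewrite oner_eq0.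
Qed.

HB.instance Definition _ := GRing.Zmodule_isNzRing.Build opp_group_algebra
  ga_mulA ga_mul1 ga_mulr1 ga_mulDl ga_mulDr ga_one_neq0.

Fact ga_scaleAl (k : F) a b : k *: (a * b) = k *: a * b.
Proof.
apply/ffunP=> m; rewrite !ffunE scaler_sumr.
by apply: eq_bigr => n _; rewrite ffunE scalerAl.
Qed.

HB.instance Definition _ :=
  GRing.Lmodule_isLalgebra.Build F opp_group_algebra ga_scaleAl.

Fact ga_scaleAr (k : F) a b : k *: (a * b) = a * (k *: b).
Proof.
apply/ffunP=> m; rewrite !ffunE scaler_sumr.
by apply: eq_bigr => n _; rewrite ffunE scalerAr.
Qed.

HB.instance Definition _ :=
  GRing.Lalgebra_isAlgebra.Build F opp_group_algebra ga_scaleAr.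

Lemma ga_oneE m : (1 : opp_group_algebra) m = (m == 1%g)%:R.
Proof. by rewrite ffunE. Qed.

Lemma ga_mulE a b m : (a * b) m = \sum_n a n * b (m * n^-1)%g.
Proof. by rewrite ffunE. Qed.

End GroupAlgebra.

(** * The algebra of fixed functions *)

Section FixedAlgebra.
Variables (F : fieldType) (L : splittingFieldType F).
Local Notation galT := (gal_of {:L}).
Local Notation permT := {perm galT}.

(** Bundling the normalisation hypothesis makes the ring structure of
    fixed_algebra inferable from its index. *)
Record normalized_group := NormalizedGroup {
  ng_group :> {group permT};
  ng_norm : [set gal_lambda g | g in 'Gal({:L} / 1)%g] \subset 'N(ng_group)%g
}.

Lemma mem_galT (g : galT) : g \in 'Gal({:L} / 1)%g.
Proof. by rewrite gal_kHom ?sub1v // k1AHom. Qed.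

Variable M : normalized_group.
Local Notation A := (opp_group_algebra L permT).

Lemma memJ_gal_lambda (g : galT) m : ((m ^ gal_lambda g)%g \in M) = (m \in M).
Proof.
by apply: memJ_norm; rewrite (subsetP (ng_norm M)) ?imset_f ?mem_galT.
Qed.

Definition fixedb : {pred A} := [pred c : A |
  [forall m, (m \notin M) ==> (c m == 0)] &&
  [forall g, forall m, c (m ^ gal_lambda g)%g == g (c m)]].

Lemma fixedbP (c : A) : reflect
  ((forall m, m \notin M -> c m = 0) /\
   (forall g m, c (m ^ gal_lambda g)%g = g (c m))) (c \in fixedb).
Proof.
rewrite inE; apply: (iffP andP) => -[h1 h2]; split.
- by move=> m mM; move/forallP/(_ m)/implyP/(_ mM)/eqP: h1.
- by move=> g m; move/forallP/(_ g)/forallP/(_ m)/eqP: h2.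
- by apply/forallP=> m; apply/implyP=> /h1/eqP.
- by apply/forallP=> g; apply/forallP=> m; apply/eqP.
Qed.

(** Outside M both sides of the invariance condition vanish, since conjugation
    by a translation preserves M. *)
Lemma fixed_group_algebraP (c : A) :
  reflect (fixed_group_algebra M c) (c \in fixedb).
Proof.
apply: (iffP (fixedbP c)) => -[c0 cJ]; split=> // g m.
have [/cJ-> // | mM] := boolP (m \in M).
by rewrite !c0 ?memJ_gal_lambda ?rmorph0.
Qed.

Fact fixedb_subalg : subalg_closed fixedb.
Proof.
split=> [|k a b /fixedbP[a0 aJ] /fixedbP[b0 bJ]|a b /fixedbP[a0 aJ] /fixedbP[b0 bJ]].
- apply/fixedbP; split=> [m mM|g m]; rewrite !ga_oneE.
    by case: eqP => // m1; rewrite m1 group1 in mM.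
  by rewrite -{1}(conj1g (gal_lambda g)) (inj_eq (conjg_inj _)) rmorph_nat.
- apply/fixedbP; split=> [m mM|g m]; rewrite !ffunE.
    by rewrite a0 // b0 // scaler0 addr0.
  by rewrite aJ bJ rmorphD /= linearZ.
- apply/fixedbP; split=> [m mM|g m]; rewrite !ga_mulE.
    apply: big1 => n _; have [nM|/a0->] := boolP (n \in M); last by rewrite mul0r.
    by rewrite b0 ?mulr0 // groupMr ?groupV.
  rewrite (reindex_inj (conjg_inj (gal_lambda g))) rmorph_sum /=.
  apply: eq_bigr => n _.
  by rewrite rmorphM /= -aJ -bJ conjMg conjVg.
Qed.

HB.instance Definition _ :=
  GRing.isSubalgClosed.Build F A fixedb fixedb_subalg.

Record fixed_algebra :=
  FixedAlgebra { fa_val : A; fa_valP : fa_val \in fixedb }.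

HB.instance Definition _ := [isSub for fa_val].
HB.instance Definition _ := [Choice of fixed_algebra by <:].
HB.instance Definition _ := [SubChoice_isSubAlgebra of fixed_algebra by <:].

End FixedAlgebra.

(** * Galois descent *)

Section Descent.
Variables (F : fieldType) (L : splittingFieldType F).
Hypothesis hgal : galois 1 {:L}.
Local Notation galT := (gal_of {:L}).
Local Notation permT := {perm galT}.

Lemma galT_full : ('Gal({:L} / 1) = [set: galT])%g.
Proof. by apply/setP=> g; rewrite mem_galT inE. Qed.

Lemma fixedField_galT : fixedField [set: galT] = 1%VS.
Proof. by rewrite -galT_full; apply/galois_fixedField. Qed.

Lemma gal_mulE (g h : galT) x : (g * h)%g x = h (g x).
Proof. by rewrite galM // memvf. Qed.

Lemma gal_1E x : (1%g : galT) x = x.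
Proof. by rewrite gal_id. Qed.

Lemma gal_fixed_base (x : L) : (forall g : galT, g x = x) -> exists a : F, x = a%:A.
Proof.
move=> fx; apply/vlineP; rewrite -fixedField_galT.
by apply/fixedFieldP; rewrite ?memvf // => g _.
Qed.

(** With w a basis of L over F and w' its dual basis for the trace form, moved by
    g, this is the invertibility of the matrix of the values g (w i). *)
Lemma gal_dual_basis : exists n (w : 'I_n -> L) (w' : galT -> 'I_n -> L),
  [/\ forall g h : galT, \sum_i h (w i) * w' g i = (h == g)%:R,
      forall i j, \sum_g w' g i * g (w j) = (i == j)%:R
    & forall x : L, exists a : 'I_n -> F, x = \sum_i a i *: w i].
Proof.
have [w _ [uW _ /(_ (groupP _)) sumW]] := gal_matrix [set: galT].
set W := (\matrix_(i, j) _) in uW; set n := #|[set: galT]| in w W uW sumW.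
pose rk := @enum_rank_in _ (1%g : galT) [set: galT] (in_setT _).
have rkK g : enum_val (rk g) = g by rewrite enum_rankK_in ?inE.
exists n, (tnth w), (fun g i => invmx W i (rk g)); split=> [g h|i j|x].
- have /matrixP/(_ (rk h) (rk g)) := mulmxV uW; rewrite !mxE.
  rewrite (inj_eq (can_inj rkK)) => <-.
  by apply: eq_bigr => i _; rewrite mxE rkK.
- have /matrixP/(_ i j) := mulVmx uW; rewrite !mxE => <-.
  rewrite (eq_bigl (mem [set: galT])) => [|g]; last by rewrite !inE.
  rewrite big_enum_val /=.
  by apply: eq_bigr => k _; rewrite mxE /rk enum_valK_in.
- have: x \in (\sum_i fixedField [set: galT] * <[tnth w i]>)%VS.
    by rewrite sumW memvf.
  case/memv_sumP=> v vw ->.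
  have /fin_all_exists[a av] i : exists a : F, v i = a *: tnth w i.
    by apply/vlineP; have := vw i isT; rewrite fixedField_galT prod1v.
  by exists a; apply: eq_bigr => i _; rewrite av.
Qed.

Variable M : normalized_group L.
Local Notation A := (opp_group_algebra L permT).
Local Notation H := (fixed_algebra M).

Lemma fa_out (h : H) m : m \notin M -> fa_val h m = 0.
Proof. by case/fixedbP: (valP h) => h0 _; apply: h0. Qed.

Lemma fa_conj (h : H) (g : galT) m : fa_val h (m ^ gal_lambda g)%g = g (fa_val h m).
Proof. by case/fixedbP: (valP h). Qed.

Lemma big_fixed_algebra (h : H) (c : permT -> L) :
  \sum_(m in M) fa_val h m * c m = \sum_m fa_val h m * c m.
Proof.
rewrite [RHS](bigID (mem M)) /= [X in _ = _ + X]big1 ?addr0 // => m mM.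
by rewrite fa_out ?mul0r.
Qed.

Lemma gal_lambdaM : {morph @gal_lambda F L : g h / (g * h)%g}.
Proof. by move=> g h; apply/permP=> d; rewrite permM !permE mulgA. Qed.

(** The point mass at m lies in the L-span of the fixed functions: summing
    g (w i) times the point mass at m ^ lambda(g) over all g is a fixed
    function, and the dual basis isolates the term with g = 1. *)
Lemma fixed_algebra_span : exists n (u : 'I_n -> permT -> H)
    (w : 'I_n -> L),
  forall m n, m \in M -> \sum_i w i * fa_val (u i m) n = (n == m)%:R.
Proof.
have [n [w [w' [ww' _ _]]]] := gal_dual_basis.
pose uf i m : A := if m \in M then
  [ffun n => \sum_(g : galT | n == (m ^ gal_lambda g)%g) g (w i)] else 0.
have uP i m : uf i m \in fixedb M.
  rewrite /uf; case: ifP => mM; last exact: rpred0.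
  apply/fixedbP; split=> [k kM|g k]; rewrite !ffunE.
    apply: big1 => g /eqP kE; case/negP: kM.
    by rewrite kE memJ_gal_lambda.
  rewrite rmorph_sum (reindex_inj (mulIg g)) /=; apply: eq_big => h.
    by rewrite gal_lambdaM conjgM (inj_eq (conjg_inj _)).
  by rewrite gal_mulE.
exists n, (fun i m => FixedAlgebra (uP i m)), (w' 1%g) => m k mM.
rewrite /= /uf mM.
under eq_bigr do rewrite ffunE mulr_sumr.
rewrite exchange_big /=.
under eq_bigr => g _.
  under eq_bigr do rewrite mulrC.
  rewrite ww'; over.
rewrite big_mkcond (bigD1 1%g) //= big1 ?addr0 => [|g /negPf->].
  have -> : gal_lambda (1%g : galT) = 1%g.
    by apply/permP=> d; rewrite permE perm1 mulg1.
  by rewrite conjg1 eqxx; case: eqP.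
by case: ifP.
Qed.

(** The spanning family contains an L-basis b of all the functions on M, as a
    square invertible submatrix.  The point is that the inverse matrix, the dual
    basis b', consists of fixed functions too, so that the coordinates of fixed
    functions are fixed by the Galois group, hence lie in F. *)
Lemma fixed_algebra_dual_bases : exists r (b b' : 'I_r -> H),
  forall m n, m \in M -> \sum_i fa_val (b' i) m * fa_val (b i) n = (m == n)%:R.
Proof.
have [n [u [w uw]]] := fixed_algebra_span.
pose r := #|M|; pose I : finType := ('I_n * 'I_r)%type.
pose up (p : 'I_#|I|) := u (enum_val p).1 (enum_val (enum_val p).2).
pose U := \matrix_(p < #|I|, j < r) fa_val (up p) (enum_val j).
have fullU : row_full U.
  apply/row_fullP; exists (\matrix_(j < r, p < #|I|)
    (if (enum_val p).2 == j then w (enum_val p).1 else 0)).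
  apply/matrixP=> j k; rewrite !mxE.
  under eq_bigr do rewrite !mxE /up.
  pose G a c := (if c == j then w a else 0) * fa_val (u a (enum_val c)) (enum_val k).
  rewrite -(big_enum_val (fun p : I => G p.1 p.2)) /=.
  rewrite -(pair_bigA _ G) /G /=.
  under eq_bigr => a _.
    rewrite (bigD1 j) //= eqxx big1 ?addr0 => [|c /negPf->]; last first.
      by rewrite mul0r.
    over.
  by rewrite uw ?enum_valP // (inj_eq enum_val_inj) eq_sym.
pose B := rowsub (fullrankfun fullU) U.
have uB : B \in unitmx by apply: fullrowsub_unit.
pose b i := up (fullrankfun fullU i).
have BE i j : B i j = fa_val (b i) (enum_val j) by rewrite !mxE.
pose bf i : A := [ffun m => \sum_(j : 'I_r | enum_val j == m) invmx B j i].
have bfE i j : bf i (enum_val j) = invmx B j i.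
  by rewrite ffunE (big_pred1 j) // => k; rewrite (inj_eq enum_val_inj).
have bf0 i m : m \notin M -> bf i m = 0.
  move=> mM; rewrite ffunE big1 // => j /eqP mE.
  by rewrite -mE enum_valP in mM.
have bb i j : \sum_(m in M) fa_val (b i) m * bf j m = (i == j)%:R.
  rewrite big_enum_val /=; have /matrixP/(_ i j) := mulmxV uB.
  by rewrite !mxE => <-; apply: eq_bigr => k _; rewrite BE bfE.
have bb' m k : m \in M -> \sum_i bf i m * fa_val (b i) k = (m == k)%:R.
  move=> mM; have [kM|kM] := boolP (k \in M); last first.
    rewrite big1 => [|i _]; last by rewrite fa_out ?mulr0.
    by case: eqP kM => // <-; rewrite mM.
  pose rk := enum_rank_in mM.
  have mE : m = enum_val (rk m) by rewrite enum_rankK_in.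
  have kE : k = enum_val (rk k) by rewrite enum_rankK_in.
  rewrite mE kE (inj_eq enum_val_inj).
  have /matrixP/(_ (rk m) (rk k)) := mulVmx uB; rewrite !mxE => <-.
  by apply: eq_bigr => i _; rewrite BE bfE.
(* A left inverse of an equivariant matrix is equivariant, by uniqueness. *)
have bfP i : bf i \in fixedb M.
  apply/fixedbP; split=> [m /bf0-> //|g m].
  have [mM|mM] := boolP (m \in M); last by rewrite !bf0 ?memJ_gal_lambda ?rmorph0.
  have mgM : (m ^ gal_lambda g)%g \in M by rewrite memJ_gal_lambda.
  have eqk k : k \in M -> \sum_i (bf i (m ^ gal_lambda g)%g - g (bf i m)) *
      fa_val (b i) k = 0.
    move=> kM; rewrite -[k](conjgKV (gal_lambda g)).
    under eq_bigr do rewrite mulrBl {2}fa_conj -rmorphM.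
    rewrite sumrB bb' // -rmorph_sum bb' // rmorph_nat.
    by rewrite (inj_eq (conjg_inj _)) subrr.
  apply/eqP; rewrite -subr_eq0; apply/eqP.
  have : \sum_(k in M) (\sum_j (bf j (m ^ gal_lambda g)%g - g (bf j m)) *
      fa_val (b j) k) * bf i k = 0.
    by apply: big1 => k /eqk->; rewrite mul0r.
  under eq_bigr do rewrite mulr_suml.
  rewrite exchange_big /=.
  under eq_bigr => j _.
    under eq_bigr do rewrite -mulrA.
    rewrite -mulr_sumr bb; over.
  rewrite (bigD1 i) //= eqxx mulr1 big1 ?addr0 // => j /negPf->.
  by rewrite mulr0.
by exists r, b, (fun i => FixedAlgebra (bfP i)).
Qed.

End Descent.

(** * The Hopf algebra of fixed functions *)

Section LinearFacts.
Variables (F : fieldType) (V U : lmodType F) (f : V -> U).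
Hypothesis lf : linear f.

Lemma is_linear_sum (I : Type) (r : seq I) (P : pred I) (v : I -> V) :
  f (\sum_(i <- r | P i) v i) = \sum_(i <- r | P i) f (v i).
Proof.
pose g : {linear V -> U} := HB.pack f (GRing.isLinear.Build _ _ _ _ f lf).
exact: (linear_sum g).
Qed.

Lemma is_linear_scale a v : f (a *: v) = a *: f v.
Proof.
pose g : {linear V -> U} := HB.pack f (GRing.isLinear.Build _ _ _ _ f lf).
exact: (linearZ_LR g).
Qed.
End LinearFacts.

Section Regular.
Variables (T : finType) (M : {group {perm T}}).
Hypothesis regM : regular_subgroup M.

Lemma regular_inj x : {in M &, injective (fun m : {perm T} => m x)}.
Proof.
move=> m n mM nM /= mn; have /andP[_ /forallP/(_ x)/eqP C1] := regM.
apply/eqP; rewrite eq_mulgV1 -in_set1 -[[set _]]C1 inE groupM ?groupV //=.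
by apply/astab1P; rewrite /= apermE permM mn permK.
Qed.

Lemma regular_trans x y : exists2 m, m \in M & m x = y.
Proof.
have /andP[/atransP/(_ x) trM _] := regM.
have /orbitP[m mM my] : y \in orbit 'P M x by rewrite trM inE.
by exists m.
Qed.

Lemma regular_card (x : T) : #|M| = #|T|.
Proof.
rewrite -(card_in_imset (regular_inj (x := x))) -cardsT; congr #|pred_of_set _|.
apply/setP=> y; rewrite inE; have [m mM <-] := regular_trans x y.
by rewrite imset_f.
Qed.
End Regular.

Section HopfAlgebra.
Variables (F : fieldType) (L : splittingFieldType F).
Hypothesis hgal : galois 1 {:L}.
Local Notation galT := (gal_of {:L}).
Local Notation permT := {perm galT}.
Variable M : normalized_group L.
Local Notation A := (opp_group_algebra L permT).
Local Notation H := (fixed_algebra M).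

Lemma faP (g h : H) : (forall m, fa_val g m = fa_val h m) -> g = h.
Proof. by move=> gh; apply/val_inj/ffunP. Qed.

Lemma fa_scaleE a (h : H) m : fa_val (a *: h) m = a *: fa_val h m.
Proof. by rewrite -[fa_val _]/(val _) linearZ ffunE. Qed.

Lemma fa_addE (g h : H) m : fa_val (g + h) m = fa_val g m + fa_val h m.
Proof. by rewrite -[fa_val _]/(val _) linearD ffunE. Qed.

Definition base_coord (x : L) : F := coord [tuple (1 : L)] ord0 x.

(** base_coord inverts the embedding of F in L on the fixed elements. *)
Lemma base_coordE (x : L) : (forall g : galT, g x = x) -> (base_coord x)%:A = x.
Proof.
case/(gal_fixed_base hgal)=> a ->; rewrite /base_coord linearZ /=.
have free1 : free [tuple (1 : L)].
  by rewrite free_cons span_nil memv0 oner_neq0 nil_free.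
by have /= -> := coord_free ord0 ord0 free1; rewrite mulr1.
Qed.

Definition coeff_sum (h : H) : F := base_coord (\sum_m fa_val h m).

Lemma coeff_sumE h : (coeff_sum h)%:A = \sum_m fa_val h m.
Proof.
apply: base_coordE => g; rewrite rmorph_sum.
rewrite [RHS](reindex_inj (conjg_inj (gal_lambda g))).
by apply: eq_bigr => m _; rewrite fa_conj.
Qed.

Lemma alg_inj (a c : F) : a%:A = c%:A :> L -> a = c.
Proof. exact: (fmorph_inj (in_alg L)). Qed.

Lemma coeff_sum_linear : scalar coeff_sum.
Proof.
move=> a g h; apply: alg_inj; rewrite scalerDl -scalerA !coeff_sumE scaler_sumr.
by rewrite -big_split; apply: eq_bigr => m _; rewrite fa_addE fa_scaleE.
Qed.

Fact pointwise_subproof (h k : H) :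
  ([ffun m => fa_val h m * fa_val k m] : A) \in fixedb M.
Proof.
apply/fixedbP; split=> [m mM|g m]; rewrite !ffunE; first by rewrite fa_out ?mul0r.
by rewrite !fa_conj rmorphM.
Qed.
Definition pointwise h k : H := FixedAlgebra (pointwise_subproof h k).

Lemma pointwiseE h k m : fa_val (pointwise h k) m = fa_val h m * fa_val k m.
Proof. by rewrite /= ffunE. Qed.

Fact antipode_subproof (h : H) : ([ffun m => fa_val h m^-1%g] : A) \in fixedb M.
Proof.
apply/fixedbP; split=> [m mM|g m]; rewrite !ffunE; first by rewrite fa_out ?groupV.
by rewrite -conjVg fa_conj.
Qed.
Definition fa_antipode h : H := FixedAlgebra (antipode_subproof h).

Lemma fa_antipodeE h m : fa_val (fa_antipode h) m = fa_val h m^-1%g.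
Proof. by rewrite /= ffunE. Qed.

Lemma fa_sumE (I : Type) (s : seq I) (P : pred I) (h : I -> H) m :
  fa_val (\sum_(i <- s | P i) h i) m = \sum_(i <- s | P i) fa_val (h i) m.
Proof. by rewrite -[fa_val _]/(val _) linear_sum sum_ffunE. Qed.

Lemma fa_oneE m : fa_val (1 : H) m = (m == 1%g)%:R.
Proof. exact: ga_oneE. Qed.

Lemma fa_mulE (g h : H) m : fa_val (g * h) m = \sum_n fa_val g n * fa_val h (m * n^-1)%g.
Proof. exact: ga_mulE. Qed.

Variables (r : nat) (b b' : 'I_r -> H).
Hypothesis bb' :
  forall m n, m \in M -> \sum_i fa_val (b' i) m * fa_val (b i) n = (m == n)%:R.

Definition fa_coord i (h : H) : F := coeff_sum (pointwise h (b' i)).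

Lemma fa_coordE i h : (fa_coord i h)%:A = \sum_m fa_val h m * fa_val (b' i) m.
Proof. by rewrite coeff_sumE; apply: eq_bigr => m _; rewrite pointwiseE. Qed.

Lemma fa_coord_sum h : h = \sum_i fa_coord i h *: b i.
Proof.
apply: faP => n; rewrite fa_sumE.
under eq_bigr do rewrite fa_scaleE -mulr_algl fa_coordE mulr_suml.
rewrite exchange_big /=.
under eq_bigr => m _.
  under eq_bigr do rewrite -mulrA.
  rewrite -mulr_sumr; over.
rewrite (bigD1 n) //= [X in _ = _ + X]big1 ?addr0 => [|m /negPf mn].
  have [nM|nM] := boolP (n \in M); first by rewrite bb' // eqxx mulr1.
  by rewrite fa_out // mul0r.
have [mM|mM] := boolP (m \in M); first by rewrite bb' // mn mulr0.
by rewrite fa_out // mul0r.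
Qed.

Lemma bilinear_expand (V U : lmodType F) (B : V -> H -> U) (s : seq (V * H)) :
  bilinear_map B ->
  \sum_(p <- s) B p.1 p.2 =
  \sum_i B (\sum_(p <- s) fa_coord i p.2 *: p.1) (b i).
Proof.
move=> [linl linr].
under [RHS]eq_bigr do rewrite (is_linear_sum (linl _)).
rewrite exchange_big /=; apply: eq_bigr => p _.
rewrite {1}(fa_coord_sum p.2) (is_linear_sum (linr _)).
apply: eq_bigr => i _.
by rewrite (is_linear_scale (linr _)) (is_linear_scale (linl _)).
Qed.

(** Two tensors over F agree as soon as their evaluations at the elements of M
    do, because the evaluations determine the coordinates on b.  The following
    two lemmas are the same principle for fixed functions in the other
    factors. *)
Lemma tensor_eq_field (s t : seq (L * H)) :
  (forall m, m \in M ->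
     \sum_(p <- s) p.1 * fa_val p.2 m = \sum_(p <- t) p.1 * fa_val p.2 m) ->
  tensor_eq s t.
Proof.
move=> st U B linB; rewrite !bilinear_expand //.
have ex i (q : seq (L * H)) : \sum_(p <- q) fa_coord i p.2 *: p.1 =
    \sum_m (\sum_(p <- q) p.1 * fa_val p.2 m) * fa_val (b' i) m.
  under [RHS]eq_bigr do rewrite mulr_suml.
  rewrite exchange_big /=; apply: eq_bigr => p _.
  rewrite -mulr_algl fa_coordE mulrC mulr_sumr.
  by apply: eq_bigr => m _; rewrite mulrA.
apply: eq_bigr => i _; congr (B _ _); rewrite !ex; apply: eq_bigr => m _.
have [/st-> //|mM] := boolP (m \in M).
by rewrite (fa_out (b' i)) // !mulr0.
Qed.

Lemma tensor_eq_fa (s t : seq (H * H)) :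
  (forall m n, \sum_(p <- s) fa_val p.1 m * fa_val p.2 n =
               \sum_(p <- t) fa_val p.1 m * fa_val p.2 n) ->
  tensor_eq s t.
Proof.
move=> st U B linB; rewrite !bilinear_expand //.
apply: eq_bigr => i _; congr (B _ _); apply: faP => m; rewrite !fa_sumE.
have ex (q : seq (H * H)) : \sum_(p <- q) fa_val (fa_coord i p.2 *: p.1) m =
    \sum_n (\sum_(p <- q) fa_val p.1 m * fa_val p.2 n) * fa_val (b' i) n.
  under [RHS]eq_bigr do rewrite mulr_suml.
  rewrite exchange_big /=; apply: eq_bigr => p _.
  rewrite fa_scaleE -mulr_algl fa_coordE mulrC mulr_sumr.
  by apply: eq_bigr => n _; rewrite mulrA.
by rewrite !ex; apply: eq_bigr => n _; rewrite st.
Qed.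

Lemma tensor3_eq_fa (s t : seq (H * H * H)) :
  (forall m n k,
     \sum_(p <- s) fa_val p.1.1 m * fa_val p.1.2 n * fa_val p.2 k =
     \sum_(p <- t) fa_val p.1.1 m * fa_val p.1.2 n * fa_val p.2 k) ->
  tensor3_eq s t.
Proof.
move=> st U B [lin1 lin2 lin3].
have ex (q : seq (H * H * H)) : \sum_(p <- q) B p.1.1 p.1.2 p.2 =
    \sum_i \sum_(p' <- [seq (fa_coord i p.2 *: p.1.1, p.1.2) | p <- q])
      B p'.1 p'.2 (b i).
  under [RHS]eq_bigr do rewrite big_map.
  rewrite exchange_big /=; apply: eq_bigr => p _.
  rewrite {1}(fa_coord_sum p.2) (is_linear_sum (lin3 _ _)).
  apply: eq_bigr => i _.
  by rewrite (is_linear_scale (lin3 _ _)) (is_linear_scale (lin1 _ _)).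
rewrite !ex; apply: eq_bigr => i _.
apply: (@tensor_eq_fa _ _ _ U (fun x y => B x y (b i))); last first.
  by split=> [w|v] a x y; [apply: lin1 | apply: lin2].
move=> m n; rewrite !big_map /=.
have ev (q : seq (H * H * H)) :
    \sum_(p <- q) fa_val (fa_coord i p.2 *: p.1.1) m * fa_val p.1.2 n =
    \sum_k (\sum_(p <- q) fa_val p.1.1 m * fa_val p.1.2 n * fa_val p.2 k) * fa_val (b' i) k.
  under [RHS]eq_bigr do rewrite mulr_suml.
  rewrite exchange_big /=; apply: eq_bigr => p _.
  rewrite fa_scaleE -mulr_algl fa_coordE -mulrA mulrC mulr_sumr.
  by apply: eq_bigr => k _; rewrite mulrA.
by rewrite !ev; apply: eq_bigr => k _; rewrite st.
Qed.

(** A Sweedler representative of the comultiplication m |-> m (x) m: the dual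
    bases write the diagonal function as the sum over i of the b i (m) b' i (n),
    and the factor h n may be absorbed in the second function. *)
Definition fa_comul (h : H) : seq (H * H) :=
  [seq (b i, pointwise h (b' i)) | i <- enum 'I_r].

Lemma fa_comulE h m n :
  \sum_(p <- fa_comul h) fa_val p.1 m * fa_val p.2 n = if m == n then fa_val h m else 0.
Proof.
rewrite big_map big_enum /=.
under eq_bigr do rewrite pointwiseE mulrCA [fa_val (b _) m * _]mulrC.
rewrite -mulr_sumr; have [nM|nM] := boolP (n \in M).
  by rewrite bb' // eq_sym; case: eqP => [->|]; rewrite ?mulr1 ?mulr0.
rewrite [fa_val h n]fa_out // mul0r.
by case: eqP => // ->; rewrite fa_out.
Qed.

(** The form in which the value of the comultiplication is used: contracting it
    with any matrix f only sees the diagonal of f. *)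
Lemma fa_comul_sum h (f : permT -> permT -> L) :
  \sum_(p <- fa_comul h) \sum_m \sum_n f m n * (fa_val p.1 m * fa_val p.2 n) =
  \sum_m f m m * fa_val h m.
Proof.
rewrite exchange_big; apply: eq_bigr => m _; rewrite exchange_big /=.
under eq_bigr do rewrite -mulr_sumr fa_comulE.
rewrite (bigD1 m) //= eqxx big1 ?addr0 // => n /negPf mn.
by rewrite eq_sym mn mulr0.
Qed.

Lemma fa_hopf : is_hopf_algebra fa_comul coeff_sum fa_antipode.
Proof.
split.
- move=> a g h; apply: tensor_eq_fa => m n.
  rewrite fa_comulE fa_addE fa_scaleE big_cat (fa_comulE h) big_map /=.
  under eq_bigr do rewrite fa_scaleE -scalerAl.
  rewrite -scaler_sumr fa_comulE.
  by case: eqP; rewrite ?scaler0 ?addr0.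
- apply: tensor_eq_fa => m n.
  rewrite fa_comulE big_seq1 /= !fa_oneE.
  by case: (m =P n) => [->|mn]; [case: eqP; rewrite ?mulr1 ?mulr0 |
    case: (m =P 1%g) => [m1|]; rewrite ?mul0r // mul1r;
    case: (n =P 1%g) => // n1; case: mn; rewrite m1].
- move=> g h; apply: tensor_eq_fa => m n.
  rewrite fa_comulE big_allpairs_dep /=.
  under eq_bigr => p _.
    under eq_bigr => q _.
      rewrite !fa_mulE mulr_suml; under eq_bigr do rewrite mulr_sumr.
      over.
    rewrite exchange_big /=.
    under eq_bigr => k _.
      rewrite exchange_big /=.
      under eq_bigr => l _.
        under eq_bigr do rewrite mulrACA mulrC.
        rewrite -mulr_suml fa_comulE.
        over.
      over.
    over.
  rewrite (fa_comul_sum g (fun k l =>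
    if (m * k^-1 == n * l^-1)%g then fa_val h (m * k^-1)%g else 0)).
  under eq_bigr do rewrite (inj_eq (mulIg _)) mulrC.
  by rewrite fa_mulE; case: eqP => // _; rewrite big1 // => k _; rewrite mulr0.
- exact: coeff_sum_linear.
- apply: alg_inj; rewrite /= coeff_sumE (bigD1 1%g) //= big1 ?addr0 => [|m /negPf m1].
    by rewrite fa_oneE eqxx scale1r.
  by rewrite fa_oneE m1.
- move=> g h; apply: alg_inj; rewrite coeff_sumE -scalerA -mulr_algl !coeff_sumE.
  under eq_bigr do rewrite fa_mulE.
  rewrite exchange_big /= mulr_suml; apply: eq_bigr => n _.
  rewrite -mulr_sumr; congr (_ * _).
  by rewrite [RHS](reindex_inj (mulIg n^-1%g)).
- move=> h; apply: tensor3_eq_fa => m n k.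
  rewrite !big_allpairs_dep /=.
  under eq_bigr do rewrite -mulr_suml fa_comulE.
  under [RHS]eq_bigr => p _.
    under eq_bigr do rewrite -mulrA.
    rewrite -mulr_sumr fa_comulE; over.
  case: (m =P n) => [<-|mn].
    rewrite fa_comulE.
    case: (m =P k) => mk; last first.
      by rewrite big1 // => p _; rewrite mulr0.
    by rewrite fa_comulE eqxx.
  rewrite big1 => [|p _]; last by rewrite mul0r.
  case: eqP => _; last by rewrite big1 // => p _; rewrite mulr0.
  by rewrite fa_comulE; case: eqP.
- move=> h; apply: faP => n; rewrite fa_sumE.
  under eq_bigr do rewrite fa_scaleE -mulr_algl coeff_sumE mulr_suml.
  rewrite exchange_big /= (bigD1 n) //= [X in _ + X = _]big1 ?addr0 => [|m /negPf mn].
    by rewrite fa_comulE eqxx.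
  by rewrite fa_comulE mn.
- move=> h; apply: faP => n; rewrite fa_sumE.
  under eq_bigr do rewrite fa_scaleE -mulr_algl coeff_sumE mulrC mulr_sumr.
  rewrite exchange_big /= (bigD1 n) //= [X in _ + X = _]big1 ?addr0 => [|m /negPf mn].
    by rewrite fa_comulE eqxx.
  by rewrite fa_comulE eq_sym mn.
- move=> a g h; apply: faP => m.
  by rewrite fa_addE fa_scaleE !fa_antipodeE fa_addE fa_scaleE.
- move=> h; apply: faP => m; rewrite fa_sumE fa_scaleE fa_oneE.
  under eq_bigr do rewrite fa_mulE.
  rewrite exchange_big /=.
  under eq_bigr => n _.
    under eq_bigr do rewrite fa_antipodeE.
    rewrite fa_comulE -{1}[n^-1%g]mul1g (inj_eq (mulIg _)).
    over.
  rewrite [1%g == m]eq_sym; case: eqP => _; last first.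
    by rewrite scaler0 big1 // => n _; case: ifP.
  by rewrite coeff_sumE [RHS](reindex_inj invg_inj).
- move=> h; apply: faP => m; rewrite fa_sumE fa_scaleE fa_oneE.
  under eq_bigr do rewrite fa_mulE.
  rewrite exchange_big /=.
  under eq_bigr => n _.
    under eq_bigr do rewrite fa_antipodeE invMg invgK.
    rewrite fa_comulE -{1}[n]mulg1 (inj_eq (mulgI _)).
    over.
  rewrite [1%g == _]eq_sym invg_eq1; case: eqP => _; last first.
    by rewrite scaler0 big1 // => n _; case: ifP.
  by rewrite coeff_sumE.
Qed.

End HopfAlgebra.

(** * The action on the field *)

Section Evaluation.
Variables (F : fieldType) (L : splittingFieldType F).
Local Notation galT := (gal_of {:L}).
Local Notation permT := {perm galT}.

(** The automorphism by which m acts on L. *)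
Definition gal_at (m : permT) : galT := (m^-1)%g (1%g : galT).

(** The reason why the action is compatible with products: moving gal_at n past
    the coefficient of k conjugates k by the corresponding translation. *)
Lemma gal_at_mul (k n : permT) :
  gal_at (k ^ gal_lambda (gal_at n) * n)%g = (gal_at k * gal_at n)%g.
Proof.
rewrite {1}/gal_at invMg permM -conjVg -/(gal_at n); set s := gal_at n.
have {2}<- : gal_lambda s 1%g = s by rewrite permE mul1g.
by rewrite permJ permE.
Qed.

Variable M : {group permT}.
Hypothesis regM : regular_subgroup M.

Lemma gal_at_inj : {in M &, injective gal_at}.
Proof.
move=> m n mM nM; rewrite /gal_at => mn; apply: invg_inj.
by apply: (regular_inj regM (x := 1%g)); rewrite ?groupV.
Qed.

Lemma gal_at_surj : exists mm : galT -> permT,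
  forall g, mm g \in M /\ gal_at (mm g) = g.
Proof.
apply: (@fin_all_exists _ _ (fun g m => m \in M /\ gal_at m = g)) => g.
 have [m mM mg] := regular_trans regM 1%g g.
by exists m^-1%g; rewrite groupV /gal_at invgK.
Qed.

Lemma big_gal_at (mm : galT -> permT) (f : permT -> L) :
  (forall g, mm g \in M /\ gal_at (mm g) = g) ->
  \sum_(m in M) f m = \sum_g f (mm g).
Proof.
move=> mmP; rewrite (reindex_onto mm gal_at) => [|m mM]; last first.
  by apply: gal_at_inj; rewrite // ?(mmP _).1 ?(mmP _).2.
by apply: eq_bigl => g; case: (mmP g) => -> ->; rewrite eqxx.
Qed.

Lemma gal_at_independent (c : permT -> L) :
  (forall x, \sum_(m in M) c m * gal_at m x = 0) -> {in M, forall m, c m = 0}.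
Proof.
move=> c0 m mM; have [mm mmP] := gal_at_surj.
have mE : m = mm (gal_at m).
  by apply: gal_at_inj; rewrite ?(mmP _).1 ?(mmP _).2.
rewrite mE; pose cg g := c (mm g).
apply: (@gal_independent _ _ _ predT cg) => // x _.
rewrite -[RHS](c0 x) (big_gal_at _ mmP).
by apply: eq_bigr => g _; rewrite (mmP g).2.
Qed.

End Evaluation.

Section HopfGalois.
Variables (F : fieldType) (L : splittingFieldType F).
Hypothesis hgal : galois 1 {:L}.
Local Notation galT := (gal_of {:L}).
Local Notation permT := {perm galT}.
Variable M : normalized_group L.
Hypothesis regM : regular_subgroup M.
Local Notation H := (fixed_algebra M).

Definition fa_act (h : H) (x : L) : L := \sum_(m in M) fa_val h m * gal_at m x.

Variables (r : nat) (b b' : 'I_r -> H).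
Hypothesis bb' :
  forall m n, m \in M -> \sum_i fa_val (b' i) m * fa_val (b i) n = (m == n)%:R.

Lemma fa_act_full h x : fa_act h x = \sum_m fa_val h m * gal_at m x.
Proof. exact: (big_fixed_algebra h (fun m => gal_at m x)). Qed.

Lemma fa_module_algebra :
  is_module_algebra (fa_comul b b') (@coeff_sum _ _ M) fa_act.
Proof.
split.
- move=> x a g h; rewrite /fa_act scaler_sumr -big_split.
  apply: eq_bigr => m _; by rewrite fa_addE fa_scaleE mulrDl scalerAl.
- move=> h a x y; rewrite /fa_act scaler_sumr -big_split /=.
  by apply: eq_bigr => m _; rewrite linearP mulrDr scalerAr.
- move=> x; rewrite fa_act_full (bigD1 1%g) //= big1 ?addr0 => [|m /negPf m1].
    by rewrite (fa_oneE M) eqxx mul1r /gal_at invg1 perm1 gal_1E.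
  by rewrite (fa_oneE M) m1 mul0r.
- move=> g h x; rewrite !fa_act_full.
  under eq_bigr do rewrite fa_mulE mulr_suml.
  rewrite exchange_big /=; apply: eq_bigr => n _.
  rewrite rmorph_sum mulr_sumr.
  rewrite (reindex_inj (mulIg n)) /=.
  rewrite (reindex_inj (conjg_inj (gal_lambda (gal_at n)))) /=.
  apply: eq_bigr => k _.
  by rewrite mulgK fa_conj gal_at_mul gal_mulE rmorphM mulrA.
- move=> h; rewrite coeff_sumE // fa_act_full.
  by apply: eq_bigr => m _; rewrite rmorph1 mulr1.
- move=> h x y; rewrite fa_act_full.
  under [RHS]eq_bigr => p _.
    rewrite !fa_act_full mulr_suml.
    under eq_bigr => m _.
      rewrite mulr_sumr.
      under eq_bigr do rewrite mulrACA mulrC.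
      over.
    over.
  rewrite (fa_comul_sum bb' h (fun m n => gal_at m x * gal_at n y)).
  by apply: eq_bigr => m _; rewrite rmorphM mulrC.
Qed.

(** Injectivity is independence of characters.  For surjectivity, an F-linear T
    agrees with the combination of automorphisms whose coefficients a are read
    off on the w i by means of the dual basis, and the dual basis b' expresses
    each automorphism by actions of the b i. *)
Lemma fa_galois : galois_map_bijective fa_act.
Proof.
split=> [s t st|T].
  apply: (tensor_eq_field hgal bb') => m mM; apply/eqP; rewrite -subr_eq0; apply/eqP.
  move: m mM; apply: (gal_at_independent regM) => x.
  under eq_bigr do rewrite mulrBl !mulr_suml.
  rewrite sumrB; have ex (q : seq (L * H)) :
      \sum_(m in M) \sum_(p <- q) p.1 * fa_val p.2 m * gal_at m x =
      galois_map fa_act q x.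
    rewrite exchange_big /=; apply: eq_bigr => p _; rewrite /fa_act mulr_sumr.
    by apply: eq_bigr => m _; rewrite mulrA.
  by rewrite !ex st subrr.
have [n [w [w' [_ ww' spanw]]]] := gal_dual_basis hgal.
pose a m : L := \sum_i T (w i) * w' (gal_at m) i.
exists [seq (a m * fa_val (b' i) m, b i) | m <- enum M, i <- enum 'I_r] => x.
rewrite /galois_map big_allpairs_dep /= big_enum /=.
have -> : \sum_(m in M) \sum_(i <- enum 'I_r)
    a m * fa_val (b' i) m * fa_act (b i) x = \sum_(m in M) a m * gal_at m x.
  apply: eq_bigr => m mM; rewrite big_enum /=.
  under eq_bigr do rewrite -mulrA fa_act_full mulr_sumr.
  rewrite -mulr_sumr exchange_big /=; congr (_ * _).
  under eq_bigr => k _.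
    under eq_bigr do rewrite mulrA.
    rewrite -mulr_suml bb' //; over.
  rewrite (bigD1 m) //= eqxx mul1r big1 ?addr0 // => k /negPf km.
  by rewrite eq_sym km mul0r.
have [mm mmP] := gal_at_surj regM.
rewrite (big_gal_at regM _ mmP).
under eq_bigr do rewrite /a !(mmP _).2.
have [c ->] := spanw x; rewrite linear_sum /=.
under eq_bigr do rewrite linear_sum mulr_sumr.
rewrite exchange_big /=; apply: eq_bigr => j _.
under eq_bigr do rewrite linearZ /= -scalerAr mulr_suml.
rewrite -scaler_sumr exchange_big /= linearZ /=; congr (_ *: _).
under eq_bigr => i _.
  under eq_bigr do rewrite -mulrA.
  rewrite -mulr_sumr ww'; over.
rewrite (bigD1 j) //= eqxx mulr1 big1 ?addr0 // => i /negPf->.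
by rewrite mulr0.
Qed.
End HopfGalois.

Section Correspondence.
Variables (F : fieldType) (L : splittingFieldType F).
Hypothesis hgal : galois 1 {:L}.
Local Notation galT := (gal_of {:L}).
Local Notation permT := {perm galT}.

Lemma GP_corresponds_ex (M : {group permT}) :
  regular_subgroup M ->
  [set gal_lambda g | g in 'Gal({:L} / 1)%g] \subset 'N(M)%g ->
  exists S : hopf_galois L, GP_corresponds M S.
Proof.
move=> regM nM; pose M' := NormalizedGroup nM.
have [r [b [b' bb']]] := fixed_algebra_dual_bases hgal M'.
exists (HopfGalois (fa_hopf hgal bb') (fa_module_algebra hgal bb')
                   (fa_galois (M := M') hgal regM bb')).
split=> //; exists (@fa_val _ _ M'); split=> /=.
- by move=> a g h; apply/ffunP=> m; rewrite [LHS]fa_addE fa_scaleE !ffunE.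
- exact: val_inj.
- move=> c; split=> [fc|[h <-]].
    have cP : (c : opp_group_algebra L permT) \in fixedb M'.
      exact/fixed_group_algebraP.
    by exists (FixedAlgebra cP).
  by apply/(fixed_group_algebraP M'); apply: fa_valP.
- exact: (fa_oneE M').
- move=> g h m; rewrite fa_mulE.
  by rewrite (big_fixed_algebra g (fun n => fa_val h (m * n^-1)%g)).
- exact: (fa_comulE bb').
- move=> h; rewrite coeff_sumE // -[RHS](eq_bigr _ (fun m _ => mulr1 _)).
  rewrite (big_fixed_algebra h (fun _ => 1)).
  by apply: eq_bigr => m _; rewrite mulr1.
- exact: fa_antipodeE.
- by [].
Qed.

End Correspondence.

(** * Structures and regular groups determine each other *)

Section Classification.
Variables (F : fieldType) (L : splittingFieldType F).
Hypothesis hgal : galois 1 {:L}.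
Local Notation galT := (gal_of {:L}).
Local Notation permT := {perm galT}.

(** An abstract Hopf-Galois structure corresponding to M is identified with the
    fixed functions, in order to use the tensor criterion there. *)
Section Transfer.
Variables (M : normalized_group L) (S : hopf_galois L).
Variable f : hg_alg S -> {ffun permT -> L}.
Hypothesis fP : is_GP_iso M f.
Local Notation H := (fixed_algebra M).

Lemma GP_preimage (h : H) : exists k : hg_alg S, f k == fa_val h.
Proof.
have /fixed_group_algebraP/(GP_image fP)[k fk] := fa_valP h.
by exists k; rewrite fk.
Qed.

Definition of_fixed h : hg_alg S := xchoose (GP_preimage h).

Lemma of_fixedK h : f (of_fixed h) = fa_val h.
Proof. exact/eqP/(xchooseP (GP_preimage h)). Qed.

Fact to_fixed_subproof k : (f k : opp_group_algebra L permT) \in fixedb M.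
Proof. by apply/fixed_group_algebraP/(GP_image fP); exists k. Qed.
Definition to_fixed k : H := FixedAlgebra (to_fixed_subproof k).

Lemma to_fixedK k : of_fixed (to_fixed k) = k.
Proof. by apply: (GP_inj fP); rewrite of_fixedK. Qed.

Lemma of_fixed_linear : linear of_fixed.
Proof.
move=> a g h; apply: (GP_inj fP); rewrite (GP_linear fP) !of_fixedK.
by apply/ffunP=> m; rewrite [LHS]fa_addE fa_scaleE !ffunE.
Qed.

Lemma tensor_eq_GP (s t : seq (hg_alg S * hg_alg S)) :
  (forall m n, \sum_(p <- s) f p.1 m * f p.2 n =
               \sum_(p <- t) f p.1 m * f p.2 n) ->
  tensor_eq s t.
Proof.
move=> st U B [linl linr].
have [r [b [b' bb']]] := fixed_algebra_dual_bases hgal M.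
pose q (s : seq (hg_alg S * hg_alg S)) := [seq (to_fixed p.1, to_fixed p.2) | p <- s].
have linB : bilinear_map (fun x y => B (of_fixed x) (of_fixed y)).
  by split=> [w|v] a x y; rewrite of_fixed_linear; [apply: linl | apply: linr].
have qE z : \sum_(p <- z) B p.1 p.2 =
    \sum_(p <- q z) B (of_fixed p.1) (of_fixed p.2).
  by rewrite big_map; apply: eq_bigr => p _; rewrite !to_fixedK.
rewrite !qE; apply: (tensor_eq_fa hgal bb' _ linB) => m n.
by rewrite !big_map; apply: st.
Qed.

(** Both separation properties hold because the L-span of the image of f
    contains the point masses of M. *)
Lemma GP_separates (c : permT -> L) :
  (forall h, \sum_(m in M) f h m * c m = 0) -> {in M, forall m, c m = 0}.
Proof.
move=> c0 m mM; have [n [u [w uw]]] := fixed_algebra_span hgal M.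
have: \sum_i w i * \sum_(k in M) f (of_fixed (u i m)) k * c k = 0.
  by apply: big1 => i _; rewrite c0 mulr0.
under eq_bigr do rewrite of_fixedK mulr_sumr.
rewrite exchange_big /=.
under eq_bigr => k _.
  under eq_bigr do rewrite mulrA.
  rewrite -mulr_suml uw //; over.
rewrite (bigD1 m) //= eqxx mul1r big1 ?addr0 // => k /andP[_ /negPf->].
by rewrite mul0r.
Qed.

Lemma GP_separates_points m n : m \in M -> (forall h, f h m = f h n) -> m = n.
Proof.
move=> mM fmn; have [r [u [w uw]]] := fixed_algebra_span hgal M.
apply/eqP; rewrite eq_sym; apply/eqP/eqP.
have : (m == m)%:R = (n == m)%:R :> L.
  rewrite -!uw //; apply: eq_bigr => i _.
  by rewrite -(of_fixedK (u i m)) fmn.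
by rewrite eqxx; case: (n == m) => // /eqP; rewrite oner_eq0.
Qed.

End Transfer.

Lemma GP_corresponds_iso (M : {group permT}) (S S' : hopf_galois L) :
  GP_corresponds M S -> GP_corresponds M S' -> hopf_galois_iso S S'.
Proof.
move=> [regM nM [f fP]] [_ _ [f' f'P]]; pose M' := NormalizedGroup nM.
pose u k := of_fixed (M := M') f'P (to_fixed (M := M') fP k).
pose u' k := of_fixed (M := M') fP (to_fixed (M := M') f'P k).
have uE k : f' (u k) = f k by rewrite of_fixedK.
have uE' k : f (u' k) = f' k by rewrite of_fixedK.
exists u; split.
- split.
    by exists u' => k; [apply: (GP_inj fP) | apply: (GP_inj f'P)];
      rewrite ?uE ?uE' ?uE.
  by move=> a g h; apply: (GP_inj f'P); rewrite (GP_linear f'P) !uE (GP_linear fP).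
- split; first by apply: (GP_inj f'P); apply/ffunP=> m;
    rewrite uE (GP_one fP) (GP_one f'P).
  move=> g h; apply: (GP_inj f'P); apply/ffunP=> m.
  by rewrite uE (GP_mul fP) (GP_mul f'P) !uE.
- move=> h; apply: (tensor_eq_GP (M := M') f'P) => m n.
  rewrite big_map (GP_comul f'P) uE -(GP_comul fP).
  by apply: eq_bigr => p _; rewrite !uE.
- split=> h; first by apply: (alg_inj (L := L)); rewrite (GP_counit fP) (GP_counit f'P) uE.
  by apply: (GP_inj f'P); apply/ffunP=> m; rewrite (GP_antipode f'P) !uE (GP_antipode fP).
- by move=> h x; rewrite (GP_act fP) (GP_act f'P) uE.
Qed.

(** An isomorphism compatible with the actions preserves the coefficient of each
    automorphism, by independence of characters, so it is induced by the
    bijection phi from M1 to M2 under which corresponding elements act by the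
    same automorphism.  As the isomorphism is multiplicative and fixed functions
    separate points, phi is multiplicative; but the permutation m is determined
    by its products: m^-1 sends gal_at n to gal_at (m * n).  Hence phi m = m. *)
Lemma GP_corresponds_sub (M1 M2 : {group permT}) (S1 S2 : hopf_galois L) :
  GP_corresponds M1 S1 -> GP_corresponds M2 S2 -> hopf_galois_iso S1 S2 ->
  M1 \subset M2.
Proof.
move=> [reg1 nM1 [f1 P1]] [reg2 nM2 [f2 P2]] [u [_ [_ uM] _ _ uact]].
pose M1' := NormalizedGroup nM1.
have [mm1 mm1P] := gal_at_surj reg1; have [mm2 mm2P] := gal_at_surj reg2.
pose phi m := mm2 (gal_at m); pose psi m := mm1 (gal_at m).
have phiM m : phi m \in M2 by case: (mm2P (gal_at m)).
have gal_phi m : gal_at (phi m) = gal_at m by case: (mm2P (gal_at m)).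
have psiM m : psi m \in M1 by case: (mm1P (gal_at m)).
have psiK m : m \in M2 -> phi (psi m) = m.
  move=> mM; apply: (gal_at_inj reg2) => //.
  by rewrite gal_phi; case: (mm1P (gal_at m)).
have fphi h m : m \in M1 -> f1 h m = f2 (u h) (phi m).
  move=> mM; apply/eqP; rewrite -subr_eq0; apply/eqP.
  move: m mM; apply: (gal_at_independent reg1) => x.
  have := uact h x; rewrite (GP_act P1) (GP_act P2) -!/(gal_at _) => uhx.
  under eq_bigr do rewrite mulrBl.
  rewrite sumrB -uhx (big_gal_at reg2 _ mm2P) (big_gal_at reg1 _ mm1P).
  apply/eqP; rewrite subr_eq0; apply/eqP; apply: eq_bigr => g _.
  by rewrite /phi -!/(gal_at _) (mm1P g).2 (mm2P g).2.
have phi_div m n : m \in M1 -> n \in M1 ->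
    gal_at (m * n^-1)%g = gal_at (phi m * (phi n)^-1)%g.
  move=> mM nM.
  have divM2 k : (phi m * (phi k)^-1)%g \in M2 by rewrite groupM ?groupV.
  have mnM : (m * n^-1)%g \in M1 by rewrite groupM ?groupV.
  rewrite -(psiK _ (divM2 n)) gal_phi; congr gal_at.
  apply: (GP_separates_points (M := M1') P1) => // h.
  apply/eqP; rewrite -subr_eq0; apply/eqP.
  (* Compare the products of g and h at m and at phi m, for all g. *)
  have := GP_separates (M := M1') P1 (c := fun k =>
    f1 h (m * k^-1)%g - f1 h (psi (phi m * (phi k)^-1)%g)).
  apply=> // g; under eq_bigr do rewrite mulrBr.
  rewrite sumrB -(GP_mul P1) fphi // uM (GP_mul P2).
  rewrite (big_gal_at reg2 _ mm2P) (big_gal_at reg1 _ mm1P).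
  apply/eqP; rewrite subr_eq0; apply/eqP; apply: eq_bigr => s _.
  have mm1M : mm1 s \in M1 by case: (mm1P s).
  have -> : mm2 s = phi (mm1 s) by rewrite /phi (mm1P s).2.
  by rewrite -fphi //; congr (_ * _); rewrite fphi // psiK.
apply/subsetP=> a aM; suff -> : a = phi a by [].
apply: invg_inj; apply/permP => t.
have [bM tE] := mm1P t; rewrite -tE; set b := mm1 t in bM tE *.
have abM : (a * b)%g \in M1 by rewrite groupM.
have := phi_div _ _ abM bM; rewrite mulgK => aE.
have phiab : phi (a * b)%g = (phi a * phi b)%g.
  apply: (canRL (mulgKV _)); apply: (gal_at_inj reg2); rewrite ?groupM ?groupV //.
  by rewrite -aE gal_phi.
have gal_atM m n : gal_at (m * n)%g = (m^-1)%g (gal_at n).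
  by rewrite /gal_at invMg permM.
by rewrite -gal_atM -gal_phi phiab gal_atM gal_phi.
Qed.

Lemma GP_corresponds_inj (M1 M2 : {group permT}) (S1 S2 : hopf_galois L) :
  GP_corresponds M1 S1 -> GP_corresponds M2 S2 -> hopf_galois_iso S1 S2 ->
  M1 = M2.
Proof.
move=> c1 c2 iso12; apply/val_inj/eqP.
rewrite eqEcard (GP_corresponds_sub c1 c2 iso12) /=.
by case: c1 c2 => [r1 _ _] [r2 _ _]; rewrite (regular_card r1 1%g) (regular_card r2 1%g).
Qed.

Lemma num_hopf_galois_card (gT : finGroupType) (G : {set gT}) :
  num_hopf_galois_of_type L G
    #|[set M : {group permT} |
        [&& regular_subgroup M,
            [set gal_lambda g | g in 'Gal({:L} / 1)%g] \subset 'N(M)%g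
          & M \isog G]]|.
Proof.
set Ms := [set M : {group permT} | _].
have MsP M : M \in Ms -> [/\ regular_subgroup M,
    [set gal_lambda g | g in 'Gal({:L} / 1)%g] \subset 'N(M)%g & M \isog G].
  by rewrite inE => /and3P.
have /fin_all_exists[S SP] (i : 'I_#|Ms|) : exists S : hopf_galois L, GP_corresponds (enum_val i) S.
  by have [regM nM _] := MsP _ (enum_valP i); apply: GP_corresponds_ex.
exists S; split=> [i|i j|S' [M cM isoM]].
- by exists (enum_val i) => //; have [] := MsP _ (enum_valP i).
- by move/(GP_corresponds_inj (SP i) (SP j))/enum_val_inj.
have MMs : M \in Ms by case: cM => regM nM _; rewrite inE regM nM.
exists (enum_rank_in MMs M); apply: (GP_corresponds_iso cM).
by have := SP (enum_rank_in MMs M); rewrite enum_rankK_in.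
Qed.

End Classification.

(** * Isomorphic regular groups are conjugate *)

Section RegularGroups.

Lemma regularP (T : finType) (x0 : T) (M : {group {perm T}}) : reflect
  ((forall x y, exists2 m, m \in M & m x = y) /\
   (forall x, {in M &, injective (fun m : {perm T} => m x)}))
  (regular_subgroup M).
Proof.
apply: (iffP idP) => [regM|[trM injM]].
  by split=> [x y|x]; [apply: regular_trans | apply: regular_inj].
apply/andP; split.
  apply/imsetP; exists x0; rewrite ?inE //; apply/setP=> y; rewrite inE.
  by have [m mM <-] := trM x0 y; apply/esym/orbitP; exists m.
apply/forallP=> x; apply/eqP/trivgP/subsetP=> m /setIP[mM /astab1P mx].
by apply/set1P/(injM x); rewrite ?group1 // perm1 -[RHS]mx.
Qed.

Definition num_regular (T : finType) (A : {set {perm T}}) (gT : finGroupType)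
    (G : {set gT}) : nat :=
  #|[set M : {group {perm T}} |
      [&& regular_subgroup M, A \subset 'N(M)%g & M \isog G]]|.

Lemma num_regular_isogr (T : finType) (A : {set {perm T}})
    (gT hT : finGroupType) (G : {group gT}) (H : {group hT}) :
  (G \isog H)%g -> num_regular A G = num_regular A H.
Proof.
move=> isoGH; apply: eq_card => M; rewrite !inE.
by rewrite (isog_transr _ isoGH).
Qed.

Section Transport.
Variables (T T' : finType) (b : T -> T') (c : T' -> T).
Hypotheses (bK : cancel b c) (cK : cancel c b).

Fact perm_transport_subproof (p : {perm T}) : injective (fun y => b (p (c y))).
Proof. by move=> x y /(can_inj bK)/perm_inj/(can_inj cK). Qed.
Definition perm_transport p : {perm T'} := perm (@perm_transport_subproof p).

Lemma perm_transportE p x : perm_transport p (b x) = b (p x).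
Proof. by rewrite permE bK. Qed.

Lemma perm_transportM : {morph perm_transport : p q / (p * q)%g}.
Proof. by move=> p q; apply/permP=> y; rewrite permM -[y]cK !perm_transportE permM. Qed.

Canonical perm_transport_morphism :=
  Morphism (D := [set: {perm T}]) (in2W perm_transportM).

Lemma injm_perm_transport : ('injm perm_transport)%g.
Proof.
apply/injmP=> p q _ _ pq; apply/permP=> x; apply: (can_inj bK).
by rewrite -!perm_transportE pq.
Qed.

Lemma perm_transport_regular (x0 : T) (M : {group {perm T}}) :
  regular_subgroup M -> regular_subgroup (perm_transport @* M)%g.
Proof.
move/(regularP x0)=> [trM injM]; apply/(regularP (b x0)); split=> [x y|x].
  have [m mM my] := trM (c x) (c y); exists (perm_transport m).
    by rewrite mem_morphim ?inE.
  by rewrite -[x]cK perm_transportE my cK.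
move=> _ _ /morphimP[m _ mM ->] /morphimP[n _ nM ->] /=.
rewrite -[x]cK !perm_transportE => /(can_inj bK)/(injM (c x))-> //.
Qed.

(** An inequality suffices, as it can be applied to the inverse bijection. *)
Lemma num_regular_transport_le (x0 : T) (A : {set {perm T}})
    (A' : {set {perm T'}}) (gT : finGroupType) (G : {group gT}) :
  (forall a', a' \in A' -> exists2 a, a \in A & forall x, a' (b x) = b (a x)) ->
  (num_regular A G <= num_regular A' G)%N.
Proof.
move=> AA'; pose tr (M : {group {perm T}}) := (perm_transport @* M)%G.
have tr_inj : injective tr.
  move=> M N /(congr1 val) /= MN; apply/val_inj => /=.
  exact: (injm_morphim_inj injm_perm_transport (subsetT _) (subsetT _) MN).
rewrite /num_regular -(card_imset _ tr_inj).
apply/subset_leq_card/subsetP=> _ /imsetP[M + ->].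
rewrite !inE => /and3P[regM nM isoM]; apply/and3P; split.
- exact: (perm_transport_regular x0).
- apply: subset_trans (morphim_norms [morphism of perm_transport] nM).
  apply/subsetP=> a' /AA'[a aA aE].
  have -> : a' = perm_transport a.
    by apply/permP=> y; rewrite -[y]cK perm_transportE aE.
  by rewrite mem_morphim ?inE.
- apply: isog_trans isoM; rewrite isog_sym.
  exact: (sub_isog (subsetT _) injm_perm_transport).
Qed.
End Transport.

(** An isomorphism f of regular groups induces a bijection of the points, because
    base points identify each set with the group acting on it. *)
Lemma regular_isog_bij (T T' : finType) (x0 : T) (x0' : T')
    (A : {group {perm T}}) (B : {group {perm T'}}) :
  regular_subgroup A -> regular_subgroup B -> (A \isog B)%g ->
  exists b : T -> T', [/\ bijective b, b x0 = x0',
    forall a, a \in A -> exists2 a', a' \in B & forall x, a' (b x) = b (a x)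
  & forall a', a' \in B -> exists2 a, a \in A & forall x, a' (b x) = b (a x)].
Proof.
move=> rA rB /isogP[f injf fA].
have [e eP] : exists e : T -> {perm T}, forall x, e x \in A /\ e x x0 = x.
  apply: (@fin_all_exists _ _ (fun x m => m \in A /\ m x0 = x)) => x.
  by have [m mA mx] := regular_trans rA x0 x; exists m.
pose b x := f (e x) x0'.
have fB a : a \in A -> f a \in B by move=> aA; rewrite -fA mem_morphim.
have bE a x : a \in A -> b (a x) = f a (b x).
  move=> aA; have [eA ex] := eP x; have [eaA eax] := eP (a x).
  have eaE : e (a x) = (e x * a)%g.
    by apply: (regular_inj rA (x := x0)); rewrite ?groupM // permM ex.
  by rewrite /b eaE morphM // permM.
have b_inj : injective b.
  move=> x y /(regular_inj rB) fxy; have [exA ex] := eP x; have [eyA ey] := eP y.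
  by rewrite -ex -ey ((injmP injf) _ _ exA eyA (fxy (fB _ exA) (fB _ eyA))).
exists b; split.
- apply: (inj_card_bij b_inj).
  by rewrite -(regular_card rA x0) -(regular_card rB x0') -fA card_injm.
- have [eA ex] := eP x0; rewrite /b.
  have -> : e x0 = 1%g.
    by apply: (regular_inj rA (x := x0)); rewrite ?group1 // perm1.
  by rewrite morph1 perm1.
- by move=> a aA; exists (f a) => [|x]; [apply: fB | rewrite bE].
- move=> a'; rewrite -fA => /morphimP[a _ aA ->]; exists a => // x.
  by rewrite bE.
Qed.

Lemma num_regular_isog (T T' : finType) (x0 : T) (x0' : T')
    (A : {group {perm T}}) (B : {group {perm T'}})
    (gT : finGroupType) (G : {group gT}) :
  regular_subgroup A -> regular_subgroup B -> (A \isog B)%g ->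
  num_regular A G = num_regular B G.
Proof.
move=> rA rB isoAB.
have [b [[c bK cK] _ AB BA]] := regular_isog_bij x0 x0' rA rB isoAB.
apply/eqP; rewrite eqn_leq (num_regular_transport_le bK cK x0 _ BA) /=.
apply: (num_regular_transport_le cK bK x0') => a /AB[a' a'B aE].
by exists a' => // y; apply: (can_inj bK); rewrite -aE !cK.
Qed.

Section RegularRepresentation.
Variable gT : finGroupType.

Definition right_mul (g : gT) : {perm gT} := perm (mulIg g).

Lemma right_mulM : {morph right_mul : g h / (g * h)%g}.
Proof. by move=> g h; apply/permP=> x; rewrite permM !permE mulgA. Qed.

Canonical right_mul_morphism :=
  Morphism (D := [set: gT]) (in2W right_mulM).

Lemma injm_right_mul : ('injm right_mul)%g.
Proof.
by apply/injmP=> g h _ _ /permP/(_ 1%g); rewrite !permE !mul1g.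
Qed.

Lemma right_mul_regular : regular_subgroup (right_mul @* [set: gT])%g.
Proof.
apply/(regularP 1%g); split=> [x y|x].
  exists (right_mul (x^-1 * y)); first by rewrite mem_morphim ?inE.
  by rewrite permE mulKVg.
move=> _ _ /morphimP[m _ _ ->] /morphimP[n _ _ ->] /=.
by rewrite !permE => /mulgI->.
Qed.

(** With permutations composed from left to right, left multiplication is an
    antimorphism; inverting makes it a morphism with the same image. *)
Definition left_mulV (g : gT) := left_mul g^-1%g.

Lemma left_mulVM : {morph left_mulV : g h / (g * h)%g}.
Proof.
by move=> g h; apply/permP=> x; rewrite permM !permE invMg mulgA.
Qed.

Canonical left_mulV_morphism :=
  Morphism (D := [set: gT]) (in2W left_mulVM).

Lemma injm_left_mulV : ('injm left_mulV)%g.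
Proof.
apply/injmP=> g h _ _ /permP/(_ 1%g); rewrite !permE !mulg1.
exact: invg_inj.
Qed.

Lemma left_mulV_regular : regular_subgroup (left_mulV @* [set: gT])%g.
Proof.
apply/(regularP 1%g); split=> [x y|x].
  exists (left_mulV (x * y^-1)); first by rewrite mem_morphim ?inE.
  by rewrite permE invMg invgK mulgKV.
move=> _ _ /morphimP[m _ _ ->] /morphimP[n _ _ ->] /=.
by rewrite !permE => /mulIg/invg_inj->.
Qed.

Lemma left_mul_set :
  [set left_mul g | g in [set: gT]] = (left_mulV @* [set: gT])%g.
Proof.
rewrite morphimEdom; apply/setP=> p; apply/imsetP/imsetP=> -[g _ ->];
  by exists g^-1%g; rewrite ?inE // /= /left_mulV ?invgK.
Qed.
End RegularRepresentation.

Lemma e_numberE (T : finType) (x0 : T) (gammaT gT : finGroupType)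
    (A : {group {perm T}}) (G : {group gT}) :
  regular_subgroup A -> (A \isog [set: gammaT])%g ->
  e_number gammaT G = num_regular A G.
Proof.
move=> rA isoA; rewrite /e_number left_mul_set.
have isoL : (left_mulV_morphism gammaT @* [set: gammaT] \isog A)%g.
  apply: (@isog_trans _ _ _ _ [set: gammaT]%G); last by rewrite isog_sym.
  by rewrite isog_sym; apply: (sub_isog _ (injm_left_mulV _)).
exact: (num_regular_isog (1%g : gammaT) x0 _ (left_mulV_regular _) rA isoL).
Qed.

Lemma num_hopf_galois_e_number (F : fieldType) (L : splittingFieldType F)
    (gammaT gT : finGroupType) (G : {group gT}) :
  galois 1 {:L} -> ('Gal({:L} / 1) \isog [set: gammaT])%g ->
  num_hopf_galois_of_type L G (e_number gammaT G).
Proof.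
move=> hgal hiso; pose A := (@right_mul (gal_of {:L}) @* [set: gal_of {:L}])%G.
have AE : [set gal_lambda g | g in 'Gal({:L} / 1)%g] = A.
  by rewrite galT_full /= morphimEdom.
rewrite (@e_numberE _ (1%g : gal_of {:L}) gammaT _ A).
- by rewrite /num_regular -AE; apply: num_hopf_galois_card.
- exact: right_mul_regular.
rewrite galT_full in hiso; apply: isog_trans hiso; rewrite isog_sym.
exact: (sub_isog _ (injm_right_mul _)).
Qed.

End RegularGroups.

(** * Geometric sums modulo an odd number *)

Section GeometricSums.
Variable R : comUnitRingType.
Implicit Types (a c x y nu : R) (m n : nat).

Definition geo a n : R := \sum_(i < n) a ^+ i.

Lemma geo0 a : geo a 0 = 0. Proof. by rewrite /geo big_ord0. Qed.

Lemma geoS a n : geo a n.+1 = a * geo a n + 1.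
Proof.
rewrite /geo big_ord_recl expr0 addrC mulr_sumr; congr (_ + _).
by apply: eq_bigr => i _; rewrite exprS.
Qed.

Lemma geo1 a : geo a 1 = 1. Proof. by rewrite geoS geo0 mulr0 add0r. Qed.

Lemma geoD a m n : geo a (m + n) = geo a m + a ^+ m * geo a n.
Proof.
elim: m => [|m IHm]; first by rewrite geo0 add0r expr0 mul1r.
by rewrite addSn !geoS IHm exprS; ring.
Qed.

Lemma geoM a m n : geo a (m * n) = geo a m * geo (a ^+ m) n.
Proof.
elim: n => [|n IHn]; first by rewrite muln0 !geo0 mulr0.
by rewrite mulnS geoD IHn geoS; ring.
Qed.

Lemma geo_subX1 a n : a ^+ n = 1 + (a - 1) * geo a n.
Proof. by rewrite -subrX1 addrC subrK. Qed.

(** Expansions of geo (1 + nu) n modulo nu and modulo nu ^+ 2; only divisibility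
    of the error terms matters. *)
Lemma geo_expand1 nu n : exists z, geo (1 + nu) n = n%:R + nu * z.
Proof.
elim: n => [|n [z IHn]]; first by exists 0; rewrite geo0; ring.
by exists (n%:R + (1 + nu) * z); rewrite geoS IHn -natr1; ring.
Qed.

Lemma expr1D_expand nu n : exists z, (1 + nu) ^+ n = 1 + nu * z.
Proof. by exists (geo (1 + nu) n); rewrite geo_subX1; ring. Qed.

Lemma geo_expand2 nu n :
  exists z, geo (1 + nu) n = n%:R + nu * 'C(n, 2)%:R + nu ^+ 2 * z.
Proof.
elim: n => [|n [z IHn]]; first by exists 0; rewrite geo0 bin0n /=; ring.
exists ('C(n, 2)%:R + (1 + nu) * z).
by rewrite geoS IHn binS bin1 natrD -natr1; ring.
Qed.

End GeometricSums.

Section ModularArithmetic.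
Variable N : nat.
Hypotheses (N1 : (1 < N)%N) (Nodd : odd N).
Local Notation R := 'Z_N.
Implicit Types (a c x y nu w : R).

Lemma val_Zp_lt x : (x < N)%N.
Proof. by case: x => m /=; rewrite Zp_cast. Qed.

Lemma dvd_modN p m : (p %| N)%N -> (p %| m %% N)%N = (p %| m)%N.
Proof. by move=> pN; rewrite /dvdn modn_dvdm. Qed.

Lemma dvd_Zp_nat p m : (p %| N)%N -> (p %| (m%:R : R))%N = (p %| m)%N.
Proof. by move=> pN; rewrite val_Zp_nat // dvd_modN. Qed.

Lemma dvd_ZpD p x y : (p %| N)%N -> (p %| (x + y)%R)%N = (p %| x + y)%N.
Proof.
move=> pN; have -> : x + y = (val x + val y)%N%:R by rewrite natrD !natr_Zp.
exact: dvd_Zp_nat.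
Qed.

Lemma dvd_ZpM p x y : (p %| N)%N -> (p %| (x * y)%R)%N = (p %| x * y)%N.
Proof.
move=> pN; have -> : x * y = (val x * val y)%N%:R by rewrite natrM !natr_Zp.
exact: dvd_Zp_nat.
Qed.

Lemma Zp_nat_eq0 m : (m%:R == 0 :> R) = (N %| m)%N.
Proof. by rewrite -val_eqE /= val_Zp_nat. Qed.

Lemma unit_ZpP x :
  reflect (forall p, prime p -> (p %| N)%N -> ~~ (p %| x)%N) (x \is a GRing.unit).
Proof.
rewrite -{2}[x]natr_Zp unitZpE //; apply: (iffP idP) => [cNx p pp pN|px].
  apply/negP=> /(coprime_dvdr) /(_ cNx) cNp.
  by have := coprime_dvdl pN cNp; rewrite /coprime gcdnn => /eqP p1; rewrite p1 in pp.
rewrite coprime_has_primes ?(ltnW N1) //; last first.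
  rewrite lt0n; apply/negP=> /eqP x0; have := px _ (pdiv_prime N1) (pdiv_dvd N).
  by rewrite x0 dvdn0.
apply/hasPn => p; rewrite !mem_primes => /and3P[pp _ pdx]; apply/negP => /and3P[_ _ pN].
by have := px p pp pN; rewrite pdx.
Qed.

(** Membership in the Jacobson radical of Z/N, which is its nilradical. *)
Definition in_radical nu := forall p, prime p -> (p %| N)%N -> (p %| nu)%N.

Lemma in_radicalM nu x : in_radical nu -> in_radical (nu * x).
Proof. by move=> snu p pp pN; rewrite dvd_ZpM // dvdn_mulr // snu. Qed.

Lemma unit_radical w nu :
  w \is a GRing.unit -> in_radical nu -> w + nu \is a GRing.unit.
Proof.
move=> /unit_ZpP uw snu; apply/unit_ZpP=> p pp pN.
by rewrite dvd_ZpD // dvdn_addl ?snu // uw.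
Qed.

Lemma unit1_radical nu : in_radical nu -> 1 + nu \is a GRing.unit.
Proof. exact: unit_radical (unitr1 _). Qed.

Lemma two_unit : (2%:R : R) \is a GRing.unit.
Proof. by rewrite unitZpE // coprime_sym coprime2n. Qed.

(** If p does not divide N this is clear, as p is then a unit.  Otherwise p is
    odd, so it divides 'C(p, 2), and it divides nu, so that in geo_expand2 both
    error terms are divisible by p * nu. *)
Lemma geo_prime nu p : in_radical nu -> prime p ->
  exists z, geo (1 + nu) p = p%:R * (1 + nu * z).
Proof.
move=> snu pp; have [pN|pN] := boolP (p %| N)%N; last first.
  have up : (p%:R : R) \is a GRing.unit.
    by rewrite unitZpE // coprime_sym prime_coprime.
  have [z ->] := geo_expand1 nu p; exists (p%:R^-1 * z).
  by rewrite mulrDr mulr1 mulrCA mulVKr.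
have [z ->] := geo_expand2 nu p.
have oddp : odd p by apply: dvdn_odd pN Nodd.
have -> : ('C(p, 2) = p * p.-1./2)%N.
  rewrite bin2 -{1}[p.-1]odd_double_half.
  have -> : odd p.-1 = false by case: p oddp {pp pN snu} => //= q /negPf.
  by rewrite add0n -doubleMr doubleK.
have [t nut] : exists t : R, nu = p%:R * t.
  exists (nu %/ p)%:R; rewrite -natrM mulnC divnK ?natr_Zp //.
  exact: snu.
exists (p.-1./2%:R + t * z); by rewrite natrM expr2 {2}nut; ring.
Qed.

(** Lifting the exponent: geo_prime at every prime factor of m, combined by the
    multiplicativity geoM, in which the base a ^+ p is again 1 modulo nu. *)
Lemma geo_lift nu m : in_radical nu -> (0 < m)%N ->
  exists z, geo (1 + nu) m = m%:R * (1 + nu * z).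
Proof.
elim/ltn_ind: m nu => m IHm nu snu m0.
have [m1|m1] := leqP m 1.
  have -> : m = 1%N by apply/eqP; rewrite eqn_leq m1.
  by exists 0; rewrite geo1; ring.
have pp := pdiv_prime m1; set p := pdiv m in pp.
have mE : m = (p * (m %/ p))%N by rewrite mulnC divnK // pdiv_dvd.
have m'0 : (0 < m %/ p)%N by rewrite divn_gt0 ?prime_gt0 // dvdn_leq // pdiv_dvd.
have m'm : (m %/ p < m)%N by rewrite ltn_Pdiv // prime_gt1.
have [y ye] := expr1D_expand nu p; have [x xe] := geo_prime snu pp.
have [z ze] := IHm _ m'm _ (in_radicalM y snu) m'0.
exists (x + y * z + nu * x * y * z).
by rewrite {1}mE geoM ye ze xe [in RHS]mE natrM; ring.
Qed.

Lemma geo_lift_unit nu m : in_radical nu -> (0 < m)%N ->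
  exists2 w, w \is a GRing.unit & geo (1 + nu) m = m%:R * w.
Proof.
move=> snu m0; have [z ->] := geo_lift snu m0.
by exists (1 + nu * z); first exact/unit1_radical/in_radicalM.
Qed.

Lemma geo_eq0 nu m : in_radical nu -> (geo (1 + nu) m == 0) = (N %| m)%N.
Proof.
move=> snu; case: (posnP m) => [->|m0]; first by rewrite geo0 eqxx dvdn0.
have [w uw ->] := geo_lift_unit snu m0.
by rewrite -(mul0r w) (inj_eq (mulIr uw)) Zp_nat_eq0.
Qed.

Lemma expr_radicalN nu : in_radical nu -> (1 + nu) ^+ N = 1.
Proof.
move=> snu; rewrite geo_subX1; have := geo_eq0 N snu; rewrite dvdnn => /eqP->.
by rewrite mulr0 addr0.
Qed.

Lemma geo_modN nu m : in_radical nu -> geo (1 + nu) (m %% N) = geo (1 + nu) m.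
Proof.
move=> snu; rewrite {2}(divn_eq m N) geoD [(_ * N)%N]mulnC exprM expr_radicalN //.
have /eqP-> : geo (1 + nu) (N * (m %/ N)) == 0 by rewrite geo_eq0 ?dvdn_mulr.
by rewrite expr1n mul1r add0r.
Qed.

(** The geometric sum with exponent in Z/N; this makes sense by geo_modN. *)
Definition geoz a x : R := geo a x.

Lemma geoz0 a : geoz a 0 = 0. Proof. exact: geo0. Qed.

Lemma geoz1 a : geoz a 1 = 1. Proof. by rewrite /geoz /= geo1. Qed.

(** Hence the iterates of z |-> (1 + nu) z + c at 0, for a unit c, are distinct:
    this affine map is an N-cycle. *)
Lemma geo_inj nu x y : in_radical nu ->
  geoz (1 + nu) x = geoz (1 + nu) y -> x = y.
Proof.
move=> snu; wlog lexy : x y / (x <= y)%N.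
  by move=> IH; have [/IH//|/ltnW/IH H /esym/H/esym] := leqP x y.
rewrite /geoz => gxy; apply: val_inj; apply/eqP; rewrite eqn_leq lexy /= -subn_eq0.
have ua := unit1_radical snu.
have: geo (1 + nu) (y - x)%N == 0.
  apply/eqP/(mulrI (unitrX x ua)); rewrite mulr0.
  by apply: (addrI (geo (1 + nu) x)); rewrite -geoD subnKC // addr0.
rewrite geo_eq0 // => Nyx; case: (posnP (y - x)%N) => [//|/dvdn_leq/(_ Nyx)].
by rewrite leqNgt (leq_ltn_trans (leq_subr _ _) (val_Zp_lt y)).
Qed.

Lemma geo_natr nu m : in_radical nu -> geoz (1 + nu) m%:R = geo (1 + nu) m.
Proof. by move=> snu; rewrite /geoz val_Zp_nat // geo_modN. Qed.

Lemma geo_ZpD nu x y : in_radical nu ->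
  geoz (1 + nu) (x + y) = geoz (1 + nu) x + (1 + nu) ^+ x * geoz (1 + nu) y.
Proof.
move=> snu; rewrite /geoz -geoD -(geo_natr (x + y) snu).
by rewrite natrD !natr_Zp.
Qed.

Lemma unit_Zp_gt0 x : x \is a GRing.unit -> (0 < x)%N.
Proof.
move=> ux; rewrite lt0n; apply/negP=> /eqP x0.
by move: ux; rewrite -[x]natr_Zp x0 unitr0.
Qed.

(** If u - 1 kills nu then the exponent u behaves like 1: by geo_lift,
    geo (1 + nu) (u - 1) is u - 1 up to a multiple of (u - 1) nu. *)
Lemma geo_fix nu (u : R) : in_radical nu -> u \is a GRing.unit -> (u - 1) * nu = 0 ->
  geoz (1 + nu) u = u /\ (1 + nu) ^+ u = 1 + nu.
Proof.
move=> snu uu unu; have u0 := unit_Zp_gt0 uu.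
have uE : (val u).-1%:R = u - 1 :> R.
  by rewrite -[X in X - 1]natr_Zp -(prednK u0) -natr1 addrK.
have gE : geo (1 + nu) (val u).-1 = u - 1.
  case: (posnP (val u).-1) => [u1|/(geo_lift snu)[z ->]].
    by rewrite -uE u1 geo0.
  by rewrite uE mulrDr mulr1 mulrA unu mul0r addr0.
rewrite /geoz -(prednK u0) geoS exprS geo_subX1 gE.
have -> : 1 + nu - 1 = nu by ring.
rewrite [nu * _]mulrC unu addr0 mulr1; split=> //.
by rewrite mulrDl [nu * _]mulrC unu; ring.
Qed.

(** The converse of the second part: (1 + nu) ^+ (u - 1) - 1 is nu (u - 1) up to
    a unit. *)
Lemma fix_geo nu (u : R) : in_radical nu -> u \is a GRing.unit ->
  (1 + nu) ^+ u = 1 + nu -> (u - 1) * nu = 0.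
Proof.
move=> snu uu; have u0 := unit_Zp_gt0 uu.
have uE : (val u).-1%:R = u - 1 :> R.
  by rewrite -[X in X - 1]natr_Zp -(prednK u0) -natr1 addrK.
rewrite /= -{1}(prednK u0) exprS => /(canRL (mulKr (unit1_radical snu))).
rewrite mulVr ?unit1_radical // geo_subX1 => /(canRL (addKr _)).
have -> : 1 + nu - 1 = nu by ring.
rewrite addNr; case: (posnP (val u).-1) => [u1 _|u1].
  by rewrite -uE u1 mul0r.
have [w uw ->] := geo_lift_unit snu u1.
rewrite uE mulrA => e0; apply: (mulIr uw).
by rewrite mul0r [_ * nu]mulrC e0.
Qed.

End ModularArithmetic.

(** * Counting conjugates, and the normaliser of L_w *)

Section CountByNormalizer.
Variables (T : finType) (x0 : T).

Lemma regular_conj (B : {group {perm T}}) (q : {perm T}) :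
  regular_subgroup B -> regular_subgroup (B :^ q)%g.
Proof.
move=> /(regularP x0)[trB injB]; apply/(regularP x0); split=> [x y|x].
  have [m mB my] := trB (q^-1%g x) (q^-1%g y); exists (m ^ q)%g.
    by rewrite memJ_conjg.
  by rewrite -[x in LHS](permKV q) permJ my permKV.
move=> _ _ /imsetP[m mB ->] /imsetP[n nB ->].
by rewrite -[x](permKV q) !permJ => /perm_inj/injB->.
Qed.

Lemma regular_isog_conj (A B : {group {perm T}}) :
  regular_subgroup A -> regular_subgroup B -> (A \isog B)%g ->
  exists2 q : {perm T}, q x0 = x0 & (A = B :^ q^-1)%G.
Proof.
move=> rA rB isoAB.
have [b [bij bx0 AB _]] := regular_isog_bij x0 x0 rA rB isoAB.
exists (perm (bij_inj bij)); first by rewrite permE.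
set q := perm _; apply/val_inj/eqP; rewrite /= eqEcard cardJg.
rewrite (regular_card rA x0) (regular_card rB x0) leqnn andbT.
rewrite -sub_conjg; apply/subsetP=> _ /imsetP[a aA ->].
have [a' a'B aE] := AB a aA; suff -> : (a ^ q)%g = a' by [].
by apply/permP=> x; rewrite -[x](permKV q) permJ /q !permE aE.
Qed.

(** A regular M isomorphic to B is a conjugate of B, by a permutation that is
    unique up to N(B) and can be chosen to fix x0; and A normalises B ^ (q^-1)
    exactly when A ^ q normalises B. *)
Lemma num_regular_normalizer (A : {set {perm T}}) (B : {group {perm T}}) :
  regular_subgroup B ->
  (num_regular A B * #|[set q in 'N(B)%g | q x0 == x0]| =
   #|[set q : {perm T} | (q x0 == x0) && (A :^ q \subset 'N(B))%g]|)%N.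
Proof.
move=> rB; set Q := [set q : {perm T} | _].
rewrite /num_regular; set Ms := [set M : {group {perm T}} | _].
pose conjB (q : {perm T}) := (B :^ q^-1)%G.
have conjQ q : q \in Q -> conjB q \in Ms.
  rewrite !inE => /andP[_ Aq]; apply/and3P; split.
  - exact: regular_conj.
  - by rewrite /= normJ -sub_conjg.
  - by rewrite isog_sym; apply: conj_isog.
rewrite -[RHS]sum1_card (partition_big conjB (mem Ms)) //=.
rewrite -sum_nat_const; apply: eq_bigr => M; rewrite inE => /and3P[rM AM isoM].
have [q0 q0x ME] := regular_isog_conj rM rB isoM.
rewrite sum1dep_card -[LHS](card_imset _ (mulgI q0)); apply: eq_card => q.
apply/imsetP/idP => [[r]|].
  case/setIdP=> rB' /eqP rx ->.
  have e : conjB (q0 * r)%g = M.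
    rewrite ME; apply/val_inj; rewrite /= invMg conjsgM.
    by rewrite (normP (groupVr rB')).
  rewrite !inE e eqxx permM q0x rx eqxx /= andbT.
  rewrite sub_conjg -normJ; suff -> : (B :^ (q0 * r)^-1)%g = M by [].
  by rewrite -e.
rewrite !inE => /andP[/andP[/eqP qx Aq] /eqP qM].
exists (q0^-1 * q)%g; last by rewrite mulKVg.
apply/setIdP; split; last by rewrite permM -{1}q0x permK qx.
rewrite -groupV invMg invgK; apply/normP.
have := congr1 val qM; rewrite ME /= conjsgM => ->.
by rewrite -conjsgM mulVg conjsg1.
Qed.

End CountByNormalizer.

Section TwoCycles.
Variable N : nat.
Hypotheses (N1 : (1 < N)%N) (Nodd : odd N).
Local Notation R := 'Z_N.
Local Notation E := ('Z_N * bool)%type.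
Implicit Types (w a c d : R) (e : E) (p q : {perm E}).

Definition origin : E := (0, false).

(** The affine shape of the elements of the normaliser: the constant term may
    differ on the two fibres. *)
Definition affine_with a (c : bool -> R) (s : bool) p :=
  forall e, p e = (a * e.1 + c e.2, s (+) e.2).

Lemma signM w (s t : bool) : w * w = 1 -> w ^+ s * w ^+ t = w ^+ (s (+) t).
Proof.
by move=> ww; case: s; case: t; rewrite /= ?expr0 ?expr1 ?mulr1 ?mul1r ?ww.
Qed.

(** The left translations of D_(2k) x C_l, in the coordinates (x, s) of the
    element with cyclic part x and involution part s. *)
Definition dihedral_trans w c (s : bool) e : E := (w ^+ s * e.1 + c, s (+) e.2).

Lemma dihedral_trans_inj w c s : w * w = 1 -> injective (dihedral_trans w c s).
Proof.
move=> ww [x t] [y t'] /pair_equal_spec /= [/addIr xy /addbI ->]; congr (_, _).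
have wK z : z = w ^+ s * (w ^+ s * z).
  by rewrite mulrA signM // addbb expr0 mul1r.
by rewrite [LHS]wK [RHS]wK xy.
Qed.

Definition dihedral_set w : {set {perm E}} :=
  [set p : {perm E} | [exists c : R, [exists s, [forall e, p e == dihedral_trans w c s e]]]].

Lemma dihedral_setP w p : reflect
  (exists c s, forall e, p e = dihedral_trans w c s e) (p \in dihedral_set w).
Proof.
rewrite inE; apply: (iffP existsP) => -[c].
  by case/existsP=> s /forallP ps; exists c, s => e; apply/eqP.
by case=> s ps; exists c; apply/existsP; exists s; apply/forallP=> e; apply/eqP.
Qed.

Lemma dihedral_group_set w : w * w = 1 -> group_set (dihedral_set w).
Proof.
move=> ww; apply/group_setP; split.
  apply/dihedral_setP; exists 0, false => -[x t].
  by rewrite perm1 /dihedral_trans /= expr0 mul1r addr0.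
move=> p q /dihedral_setP[c [s ps]] /dihedral_setP[d [t qt]].
apply/dihedral_setP; exists (w ^+ t * c + d), (t (+) s) => e.
by rewrite permM ps qt /dihedral_trans /= -signM // mulrDr mulrA addrA addbA.
Qed.

Section Group.
Variable w : R.
Hypothesis ww : w * w = 1.

Definition dihedral_gp : {group {perm E}} := Group (dihedral_group_set ww).

Definition dihedral_perm c s : {perm E} := perm (dihedral_trans_inj (c := c) (s := s) ww).

Lemma dihedral_permE c s e : dihedral_perm c s e = (w ^+ s * e.1 + c, s (+) e.2).
Proof. by rewrite permE. Qed.

Lemma dihedral_permM c d s t : (dihedral_perm c s * dihedral_perm d t)%g =
  dihedral_perm (w ^+ t * c + d) (t (+) s).
Proof.
apply/permP=> e; rewrite permM !dihedral_permE -signM //=.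
by rewrite mulrDr mulrA addrA addbA.
Qed.

Lemma mem_dihedral_perm c s : dihedral_perm c s \in dihedral_gp.
Proof. by apply/dihedral_setP; exists c, s => e; rewrite permE. Qed.

Lemma dihedral_gpP p : p \in dihedral_gp -> exists c s, p = dihedral_perm c s.
Proof.
case/dihedral_setP=> c [s ps]; exists c, s; apply/permP => e.
by rewrite ps permE.
Qed.

Lemma dihedral_regular : regular_subgroup dihedral_gp.
Proof.
apply/(regularP origin); split=> [[x s] [y t]|[x s]].
  exists (dihedral_perm (y - w ^+ (t (+) s) * x) (t (+) s)).
    exact: mem_dihedral_perm.
  by rewrite dihedral_permE /= addrC subrK addbK.
move=> _ _ /dihedral_gpP[c [t ->]] /dihedral_gpP[c' [t' ->]].
by rewrite !dihedral_permE => /pair_equal_spec /= [+ /addIb tt']; rewrite tt' => /addrI->.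
Qed.

Lemma card_two_fibres : #|{: E}| = N.*2.
Proof. by rewrite card_prod card_bool card_ord Zp_cast // muln2. Qed.

Definition shift := dihedral_perm 1 false.
Definition flip := dihedral_perm 0 true.

Lemma shiftE e : shift e = (e.1 + 1, e.2).
Proof. by rewrite dihedral_permE /= expr0 mul1r. Qed.

Lemma flipE e : flip e = (w * e.1, ~~ e.2).
Proof. by rewrite dihedral_permE /= addr0 expr1. Qed.

Lemma shiftX n e : (shift ^+ n)%g e = (e.1 + n%:R, e.2).
Proof.
elim: n => [|n IHn]; first by rewrite perm1 addr0; case: e.
by rewrite expgSr permM IHn shiftE /= -addrA natr1.
Qed.

Lemma shiftN : (shift ^+ N)%g = 1%g.
Proof. by apply/permP=> -[x s]; rewrite shiftX perm1 pchar_Zp // addr0. Qed.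

Lemma dihedral_gen : dihedral_gp \subset <<[set shift; flip]>>%g.
Proof.
apply/subsetP=> p /dihedral_gpP[c [s ->]].
have -> : dihedral_perm c s = (flip ^+ s * shift ^+ c)%g.
  apply/permP=> e; rewrite permM shiftX natr_Zp.
  case: s; rewrite /= ?expg1 ?expg0 ?flipE ?perm1 dihedral_permE /=.
    by rewrite expr1.
  by rewrite expr0 mul1r.
by rewrite groupM ?groupX ?mem_gen // !inE eqxx ?orbT.
Qed.

(** A permutation of odd order that preserves the set of the two fibres fixes
    each of them. *)
Lemma odd_no_swap p (s : bool) :
  (forall e, (p e).2 = s (+) e.2) -> (p ^+ N)%g = 1%g -> s = false.
Proof.
move=> ps pN; have pX n e : ((p ^+ n)%g e).2 = (odd n && s) (+) e.2.
  elim: n => [|n IHn]; first by rewrite perm1.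
  by rewrite expgSr permM ps IHn /= addbA; congr (_ (+) _); case: (odd n); case: (s).
by have := pX N origin; rewrite pN perm1 Nodd /= addbF => <-.
Qed.

(** An element p of the normaliser conjugates the N-cycle shift to an element of
    odd order, hence to a power of shift, which makes p affine on the fibres;
    that the conjugate of flip is a translation of L_w relates the two constant
    terms. *)
Lemma norm_dihedralP p : reflect
  (exists a (c : bool -> R) s, [/\ a \is a GRing.unit, (1 + w) * (c true - c false) = 0
                   & affine_with a c s p])
  (p \in 'N(dihedral_gp)%g).
Proof.
apply: (iffP idP) => [pN|[a [c [s [ua wc ap]]]]].
  have memJ q : q \in dihedral_gp -> (q ^ p)%g \in dihedral_gp.
    by move=> qD; rewrite memJ_norm.
  have /memJ/dihedral_gpP[a [s0 sh]] := mem_dihedral_perm 1 false.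
  have s0E : s0 = false.
    apply: (@odd_no_swap (dihedral_perm a s0)); first by move=> e; rewrite dihedral_permE.
    by rewrite -sh -conjXg shiftN conj1g.
  rewrite {}s0E in sh.
  have pS e : p (e.1 + 1, e.2) = ((p e).1 + a, (p e).2).
    by rewrite -shiftE -permJ sh dihedral_permE /= expr0 mul1r.
  have pn n t : p (n%:R, t) = (a * n%:R + (p (0, t)).1, (p (0, t)).2).
    elim: n => [|n IHn]; first by rewrite mulr0 add0r; case: (p _).
    by rewrite -natr1 (pS (n%:R, t)) IHn /=; congr (_, _); ring.
  have pE e : p e = (a * e.1 + (p (0, e.2)).1, (p (0, e.2)).2).
    by case: e => x t; rewrite -[x]natr_Zp pn.
  pose c t := (p (0, t)).1; pose s := (p origin).2.
  have surj e : exists f, p f = e by exists (p^-1%g e); rewrite permKV.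
  have sE t : (p (0, t)).2 = s (+) t.
    case: t; last by rewrite addbF.
    have [[x t]] := surj (0, ~~ s); rewrite pE /= => -[_].
    by case: t => [->|]; rewrite ?addbT // -/s; case: (s).
  have ua : a \is a GRing.unit.
    have inj_a : injective ( *%R a).
      move=> x y xy; suff [] : (x, false) = (y, false) by [].
      by apply: (@perm_inj _ p); rewrite pE [RHS]pE /= xy.
    have [ia _ aK] := injF_bij inj_a.
    by apply/unitrP; exists (ia 1); rewrite mulrC aK.
  exists a, c, s; split=> //; last by move=> e; rewrite pE sE.
  have /memJ/dihedral_gpP[d [t fl]] := mem_dihedral_perm 0 true.
  have pF e : p (w * e.1, ~~ e.2) = (w ^+ t * (p e).1 + d, t (+) (p e).2).
    by rewrite -flipE -permJ fl dihedral_permE.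
  have := pF (0, false); have := pF (0, true); rewrite /= !mulr0.
  rewrite [p (0, false)]pE [p (0, true)]pE /= !sE !mulr0 !add0r -!/(c _).
  move=> [e0 t0] [e1 _]; have tt : t = true.
    by move: t0; case: (t); case: (s).
  rewrite tt expr1 in e0 e1.
  have -> : (1 + w) * (c true - c false) = c true - c false - w * c false + w * c true.
    by ring.
  by rewrite {1}e1 {2}e0; ring.
rewrite inE; apply/subsetP=> _ /imsetP[q /dihedral_gpP[d [t ->]] ->].
apply/dihedral_setP; exists (a * d + c t - w ^+ t * c false), t => e.
rewrite -[e](permKV p); set f := (p^-1)%g e; rewrite permJ !ap dihedral_permE.
rewrite /dihedral_trans /=; congr (_, _); last by rewrite addbCA.
case: t; last by rewrite !expr0; ring.
rewrite expr1; case: f.2 => /=; last by ring.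
apply/eqP; rewrite -subr_eq0 -oppr_eq0 -[X in _ == X]wc; apply/eqP; ring.
Qed.

End Group.
End TwoCycles.
Arguments origin {N}.

(** * Parameters for the conjugating permutations *)

Section RingIdentities.
Variables (S : comUnitRingType) (u v nu c g d : S).
Hypotheses (two : (2%:R : S) \is a GRing.unit) (uu : u * u = 1)
  (unu : (u - 1) * nu = 0).

(** The equations (1 + v) * (g * c * u - nu * d - c) = 0 and
    (1 + v) * (1 + g) * d = 0 say that the constant terms of the conjugates of
    shift and flip are those of elements of the normaliser.  Multiplying the
    first by 1 + u and by u - 1 separates the primes where u is 1 from those
    where u is -1; at the former, if v is 1 there, g = -1 would make
    2 c + nu d vanish. *)
Lemma frame_constraints_nec :
  c \is a GRing.unit -> 2%:R * c + nu * d \is a GRing.unit ->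
  (1 + v) * (g * c * u - nu * d - c) = 0 -> (1 + v) * (1 + g) * d = 0 ->
  (1 + v) * (g - u) = 0 /\ (1 + u) * (1 + v) * d = 0.
Proof.
move=> uc ucd h1 h2.
have hA : (1 + v) * (1 + u) * (g - 1) = 0.
  apply: (mulIr ucd); rewrite mul0r.
  transitivity (2%:R * (1 + u) * ((1 + v) * (g * c * u - nu * d - c)) -
    2%:R * (1 + v) * g * c * (u * u - 1) + (1 + u) * nu * ((1 + v) * (1 + g) * d)).
    by ring.
  by rewrite h1 h2 uu; ring.
have hB : (1 + v) * (u - 1) * (g + 1) = 0.
  apply: (mulIr uc); rewrite mul0r.
  transitivity ((1 - u) * ((1 + v) * (g * c * u - nu * d - c)) +
    (1 + v) * g * c * (u * u - 1) - (1 + v) * d * ((u - 1) * nu)); first by ring.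
  by rewrite h1 unu uu; ring.
have hg : (1 + v) * (g - u) = 0.
  have u2 : 2%:R * u \is a GRing.unit.
    by rewrite unitrM two; apply/unitrP; exists u.
  apply: (mulIr u2); rewrite mul0r.
  transitivity ((1 + v) * (1 + u) * (g - 1) + (1 + v) * (u - 1) * (g + 1) -
    2%:R * (1 + v) * (u * u - 1)); first by ring.
  by rewrite hA hB uu; ring.
split=> //.
transitivity ((1 + v) * (1 + g) * d - (1 + v) * (g - u) * d); first by ring.
by rewrite h2 hg; ring.
Qed.

Lemma frame_constraints_suf :
  (1 + v) * (g - u) = 0 -> (1 + u) * (1 + v) * d = 0 ->
  (1 + v) * (g * c * u - nu * d - c) = 0 /\ (1 + v) * (1 + g) * d = 0.
Proof.
move=> hg hd; split; last first.
  transitivity ((1 + v) * (g - u) * d + (1 + u) * (1 + v) * d); first by ring.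
  by rewrite hg hd; ring.
apply: (mulrI two); rewrite mulr0.
transitivity (2%:R * c * u * ((1 + v) * (g - u)) +
  2%:R * (1 + v) * c * (u * u - 1) - nu * ((1 + u) * (1 + v) * d) +
  (u - 1) * nu * (1 + v) * d); first by ring.
by rewrite hg hd unu uu; ring.
Qed.
End RingIdentities.

Section Frames.
Variable N : nat.
Hypotheses (N1 : (1 < N)%N) (Nodd : odd N).
Local Notation R := 'Z_N.
Local Notation E := ('Z_N * bool)%type.
Variables (u v : R).
Hypotheses (uu : u * u = 1) (vv : v * v = 1).
Implicit Types (e : E) (q : {perm E}).
Local Notation Lu := (dihedral_gp uu).
Local Notation Lv := (dihedral_gp vv).

Let uU : u \is a GRing.unit. Proof. by apply/unitrP; exists u. Qed.
Let ucancel x : u * (u * x) = x. Proof. by rewrite mulrA uu mul1r. Qed.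

(** The image of (x, s) is X ^ x Y ^ s applied to the origin, where X acts by
    z |-> (1 + nu) z + c on the first fibre and Y sends z to g z + d in the second
    one; on the second fibre the relation X ^ x Y = Y X ^ (u x) has been used. *)
Definition frame_fun (nu c g d : R) e : E :=
  if e.2 then (g * c * geoz (1 + nu) (u * e.1) + d, true)
  else (c * geoz (1 + nu) e.1, false).

Definition frame_param (nu c g d : R) : Prop :=
  [/\ in_radical nu /\ (u - 1) * nu = 0, c \is a GRing.unit,
      g * g = 1 /\ (1 + v) * (g - u) = 0 & (1 + u) * (1 + v) * d = 0].

Lemma unit_involution (x : R) : x * x = 1 -> x \is a GRing.unit.
Proof. by move=> xx; apply/unitrP; exists x. Qed.

Lemma frame_fun_inj nu c g d : frame_param nu c g d -> injective (frame_fun nu c g d).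
Proof.
move=> [[snu _] uc [gg _] _] [x s] [y t]; rewrite /frame_fun /=.
have ug := unit_involution gg.
case: s; case: t => //= /pair_equal_spec[+ _].
  move/addIr; rewrite -!mulrA => /(mulrI ug)/(mulrI uc)/(geo_inj N1 Nodd snu).
  by move/(mulrI uU)->.
by move/(mulrI uc)/(geo_inj N1 Nodd snu)->.
Qed.

(** The conjugates of shift and flip by frame_fun are the affine maps with
    multipliers 1 + nu and g and with constant terms c, g c u - nu d and
    d, - g d. *)
Lemma frame_fun_norm nu c g d q : frame_param nu c g d -> q =1 frame_fun nu c g d ->
  q origin = origin /\ (Lu :^ q \subset 'N(Lv))%g.
Proof.
move=> [[snu unu] uc [gg gv] dv] qE.
have [gu au] := geo_fix N1 Nodd snu uU unu.
have ug := unit_involution gg.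
have [h1 h2] := frame_constraints_suf c (two_unit N1 Nodd) uu unu gv dv.
split; first by rewrite qE /frame_fun /= geoz0 mulr0.
have shN : (shift uu ^ q)%g \in 'N(Lv)%g.
  apply/(norm_dihedralP N1 Nodd).
  exists (1 + nu), (fun t => if t then g * c * u - nu * d else c), false.
  split; [exact: unit1_radical | exact: h1 | move=> f].
  rewrite -[f](permKV q); set e := (q^-1)%g f; rewrite permJ shiftE !qE.
  case: e => x [] /=; congr (_, _).
    by rewrite -[fst _]/(x + 1) mulrDr mulr1 [u * x + u]addrC geo_ZpD // gu au; ring.
  by rewrite -[fst _]/(x + 1) [x + 1]addrC geo_ZpD // geoz1; ring.
have flN : (flip uu ^ q)%g \in 'N(Lv)%g.
  apply/(norm_dihedralP N1 Nodd).
  exists g, (fun t => if t then - g * d else d), true.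
  split=> //; first by rewrite -[RHS]oppr0 -h2; ring.
  move=> f; rewrite -[f](permKV q); set e := (q^-1)%g f; rewrite permJ flipE !qE.
  case: e => x [] /=; congr (_, _).
    by rewrite -[fst _]/(u * x) mulrDr !mulrA gg; ring.
  by rewrite -[fst _]/(u * x) ucancel; ring.
rewrite sub_conjg (subset_trans (dihedral_gen uu)) // gen_subG.
by rewrite -sub_conjg; apply/subsetP=> _ /imsetP[p /set2P[] -> ->].
Qed.

(** Conversely, a q with the required properties is computed from the conjugates
    of shift and flip, which norm_dihedralP makes affine. *)
Lemma frame_exists q : q origin = origin -> (Lu :^ q \subset 'N(Lv))%g ->
  exists nu c g d, frame_param nu c g d /\ q =1 frame_fun nu c g d.
Proof.
move=> q0 /subsetP Nq.
have normJ' p : p \in Lu -> (p ^ q)%g \in 'N(Lv)%g.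
  by move=> pL; apply: Nq; rewrite memJ_conjg.
have /normJ'/(norm_dihedralP N1 Nodd)[a [cc [s [ua vc sh]]]] :=
  mem_dihedral_perm uu 1 false.
have /normJ'/(norm_dihedralP N1 Nodd)[g [dd [t [ug vd fl]]]] :=
  mem_dihedral_perm uu 0 true.
have {}sh : affine_with a cc false (shift uu ^ q).
  suff <- : s = false by [].
  apply: (odd_no_swap Nodd (p := (shift uu ^ q)%g)); first by move=> e; rewrite sh.
  by rewrite -conjXg shiftN // conj1g.
set c := cc false in vc; set d := dd false in vd.
pose nu := a - 1; have aE : a = 1 + nu by rewrite /nu; ring.
have qS e : q (e.1 + 1, e.2) = (a * (q e).1 + cc (q e).2, (q e).2).
  by rewrite -(shiftE uu) -permJ sh.
have qF e : q (u * e.1, ~~ e.2) = (g * (q e).1 + dd (q e).2, t (+) (q e).2).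
  by rewrite -flipE -permJ fl.
have q0n n : q (n%:R, false) = (c * geo a n, false).
  elim: n => [|n IHn]; first by rewrite q0 geo0 mulr0.
  by rewrite -natr1 (qS (n%:R, false)) IHn geoS /= -/c; congr (_, _); ring.
have q0x x : q (x, false) = (c * geoz a x, false).
  by rewrite -{1}[x]natr_Zp q0n.
have surj e : exists f, q f = e by exists (q^-1%g e); rewrite permKV.
have q1x x : q (x, true) = (g * (c * geoz a (u * x)) + d, t).
  by rewrite -{1}[x]ucancel (qF (u * x, false)) q0x /= addbF.
have tt : t = true.
  have [[x [] ]] := surj (0, true); first by rewrite q1x => /pair_equal_spec[].
  by rewrite q0x.
rewrite {}tt in qF q1x fl.
have onto y : exists n, c * geoz a n = y.
  have [[x [] ]] := surj (y, false); first by rewrite q1x.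
  by rewrite q0x => /pair_equal_spec[<- _]; exists x.
have uc : c \is a GRing.unit.
  by have [n cn] := onto 1; apply/unitrP; exists (geoz a n); rewrite mulrC cn.
(* A prime p not dividing nu would divide a power of the unit a: choose y with
   p dividing 1 + nu y, and n with geo a n = y. *)
have snu : in_radical nu.
  move=> p pp pN; apply/negPn/negP=> pnu.
  have [y py] : exists y : R, (p %| (1 + nu * y)%R)%N.
    have cop : coprime nu p by rewrite coprime_sym prime_coprime.
    have nu0 : (0 < nu)%N.
      by rewrite lt0n; apply: contra pnu => /eqP->; rewrite dvdn0.
    case: (egcdnP p nu0) => km kn; rewrite (eqP cop) => e1 _.
    exists (km * p.-1)%:R.
    have -> : 1 + nu * (km * p.-1)%:R = (1 + nu * (km * p.-1))%N%:R.
      by rewrite natrD (natrM _ nu) natr_Zp.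
    rewrite dvd_Zp_nat // mulnA [(nu * km)%N]mulnC e1 mulnDl mul1n.
    rewrite addnCA add1n prednK ?prime_gt0 //.
    by rewrite dvdn_add // dvdn_mulr // dvdn_mull.
  have [n cn] := onto (c * y).
  have := unitrX n ua; move/(unit_ZpP N1)/(_ p pp pN)/negP; apply.
  by rewrite geo_subX1 -/(geoz a n) (mulrI uc cn) aE [1 + nu - 1]addrC addKr.
have f10 : g * d + dd true = 0.
  have := qF (0, true); rewrite /= mulr0 q0x q1x !mulr0 geoz0 !mulr0 add0r.
  by move/pair_equal_spec => [<-].
have d1 : dd true = - (g * d) by apply/eqP; rewrite -addr_eq0 addrC f10.
have gg : g * g = 1.
  have := qF (u, true); rewrite /= q0x q1x uu geoz1 d1 !mulr1.
  move/pair_equal_spec => /= [+ _] => ggc; apply: (mulIr uc).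
  by rewrite mul1r [RHS]ggc; ring.
have {}ug : g \is a GRing.unit by apply: unit_involution.
have s0 : g * c * geoz a u + d = a * d + cc true.
  have := qS (0, true); rewrite /= add0r !q1x mulr0 geoz0 !mulr0 add0r mulr1.
  by move/pair_equal_spec => /= [<- _]; ring.
have s1 : g * c * geoz a (u + u) + d = a * (g * c * geoz a u + d) + cc true.
  have := qS (1, true); rewrite /= !q1x mulr1 mulrDr mulr1.
  by move/pair_equal_spec => /= [+ _]; rewrite mulrA => ->; ring.
rewrite aE in s0 s1 *.
have unu : (u - 1) * nu = 0.
  apply: fix_geo => //.
  have [w uw uwE] := geo_lift_unit N1 Nodd snu (unit_Zp_gt0 uU).
  have ugu : geoz (1 + nu) u \is a GRing.unit.
    by rewrite /geoz uwE natr_Zp unitrM uU.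
  apply: (mulrI ug); apply: (mulrI uc); apply: (mulIr ugu).
  rewrite geo_ZpD // in s1.
  have -> : c * (g * (1 + nu) ^+ u) * geoz (1 + nu) u =
    g * c * (geoz (1 + nu) u + (1 + nu) ^+ u * geoz (1 + nu) u) + d -
    (g * c * geoz (1 + nu) u + d) by ring.
  by rewrite s1 {2}s0; ring.
have [gu _] := geo_fix N1 Nodd snu uU unu.
have c1 : cc true = g * c * u - nu * d.
  have -> : cc true = (1 + nu) * d + cc true - (1 + nu) * d by ring.
  by rewrite -s0 gu; ring.
have u2 := two_unit N1 Nodd.
have [] // := frame_constraints_nec (v := v) (g := g) (c := c) (d := d) u2 uu unu uc.
- by apply: unit_radical; rewrite ?unitrM ?u2 //; apply: in_radicalM.
- by rewrite -c1.
- by rewrite -[RHS]oppr0 -vd d1; ring.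
move=> gv dv; exists nu, c, g, d; split=> // -[x []]; last by rewrite q0x aE.
by rewrite q1x aE mulrA.
Qed.

Lemma frame_param_inj nu c g d nu' c' g' d' :
  frame_param nu c g d -> frame_param nu' c' g' d' ->
  frame_fun nu c g d =1 frame_fun nu' c' g' d' ->
  (nu, c, g, d) = (nu', c', g', d').
Proof.
move=> [[snu _] uc _ _] [[snu' _] uc' _ _] eqf.
have cc : c = c'.
  by have := eqf (1, false); rewrite /frame_fun /= !geoz1 !mulr1 => /pair_equal_spec[].
have dd : d = d'.
  have := eqf (0, true); rewrite /frame_fun /= !mulr0 !geoz0 !mulr0 !add0r.
  by case/pair_equal_spec.
have gg : g = g'.
  have := eqf (u, true); rewrite /frame_fun /= uu !geoz1 !mulr1 cc dd.
  by case/pair_equal_spec => /addIr/(mulIr uc').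
have nn : nu = nu'.
  have := eqf (1 + 1, false); rewrite /frame_fun cc -[fst _]/(1 + 1).
  rewrite !geo_ZpD // !geoz1 !mulr1 /= !expr1 => /pair_equal_spec[+ _].
  by move/(mulrI uc')/addrI/addrI.
by rewrite cc dd gg nn.
Qed.

End Frames.

(** * Solutions of the parameter equations *)

Section Radical.

Lemma prod_primes_dvd (s : seq nat) m : uniq s -> all prime s ->
  (\prod_(p <- s) p %| m)%N = all (fun p => p %| m)%N s.
Proof.
elim: s => [|p s IHs] /=; first by rewrite big_nil dvd1n.
case/andP=> ps us /andP[pp sp]; rewrite big_cons Gauss_dvd ?IHs //.
rewrite prime_coprime //; apply/negP=> pdiv.
have: (p %| \prod_(q <- s) q)%N by [].
rewrite (big_morph _ (fun a b => Euclid_dvdM a b pp) (id1 := false)); last first.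
  by rewrite dvdn1; apply/negP => /eqP p1; rewrite p1 in pp.
rewrite big_has => /hasP[q qs]; rewrite dvdn_prime2 ?(allP sp _ qs) // => /eqP pq.
by rewrite pq qs in ps.
Qed.

Lemma radical_dvdP n m : (0 < n)%N ->
  reflect (forall p, prime p -> (p %| n)%N -> (p %| m)%N) (radical n %| m)%N.
Proof.
move=> n0; rewrite /radical prod_primes_dvd ?primes_uniq; last 2 first.
- by [].
- by apply/allP=> p; rewrite mem_primes => /andP[].
apply: (iffP allP) => h p.
  by move=> pp pn; apply: h; rewrite mem_primes pp n0 pn.
by rewrite mem_primes => /and3P[pp _ pn]; apply: h.
Qed.

Lemma radical_dvd n : (0 < n)%N -> (radical n %| n)%N.
Proof. by move=> n0; apply/radical_dvdP. Qed.

Lemma radical_gt0 n : (0 < n)%N -> (0 < radical n)%N.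
Proof. by move=> n0; apply: dvdn_gt0 (radical_dvd n0). Qed.

End Radical.

Section Counting.
Variable N : nat.
Hypotheses (N1 : (1 < N)%N) (Nodd : odd N).
Local Notation R := 'Z_N.
Implicit Types (x y w : R).

Lemma modulus_gt0 : (0 < N)%N. Proof. exact: ltnW. Qed.

Lemma Zp_eq0_dvd x : (x == 0) = (N %| x)%N.
Proof. by rewrite -[in LHS](natr_Zp x) Zp_nat_eq0. Qed.

Lemma dvd_ZpB d x y : (d %| N)%N -> (d %| (x - y)%R)%N = (x == y %[mod d]).
Proof.
move=> dN; have e : val x = ((val y + val (x - y)%R) %% N)%N.
  rewrite -val_Zp_nat // natrD !natr_Zp; congr val; ring.
by rewrite e modn_dvdm // -[X in _ == X %[mod _]]addn0 eqn_modDl mod0n.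
Qed.

Lemma card_multiples m : (m %| N)%N -> #|[set x : R | (m %| x)%N]| = (N %/ m)%N.
Proof.
move=> mN; have m0 : (0 < m)%N by apply: dvdn_gt0 mN; apply: modulus_gt0.
pose f (i : 'I_(N %/ m)) : R := (m * i)%:R.
have lt_mi (i : 'I_(N %/ m)) : (m * i < N)%N.
  by rewrite -{2}(divnK mN) mulnC ltn_pmul2r.
have fE i : nat_of_ord (f i) = (m * i)%N by rewrite /f val_Zp_nat // modn_small.
have f_inj : injective f.
  move=> i j /(congr1 (@nat_of_ord _)); rewrite !fE => /eqP; rewrite eqn_pmul2l // => /eqP.
  exact: val_inj.
rewrite -[RHS]card_ord -(card_imset _ f_inj); apply: eq_card => x.
rewrite inE; apply/idP/imsetP => [mx|[i _ ->]]; last by rewrite fE dvdn_mulr.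
have lt_x : (x %/ m < N %/ m)%N by rewrite ltn_divLR // divnK // val_Zp_lt.
by exists (Ordinal lt_x) => //; apply: ord_inj; rewrite fE /= mulnC divnK.
Qed.

Lemma annihilator_dvd k l w x : (k * l)%N = N -> (k %| w)%N -> coprime l w ->
  (w * x == 0) = (l %| x)%N.
Proof.
move=> klN kw clw; rewrite Zp_eq0_dvd dvd_ZpM //.
have lN : (l %| N)%N by rewrite -klN dvdn_mull.
apply/idP/idP => [Nwx|lx]; last by have := dvdn_mul kw lx; rewrite klN.
by rewrite -(Gauss_dvdr _ clw) (dvdn_trans lN).
Qed.

(** The exponent by which the involution of D_(2k) x C_l acts on the cyclic
    subgroup of order N = k l. *)
Definition sign_unit k l (u : R) := (k %| (1 + u)%R)%N /\ (l %| (u - 1)%R)%N.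

Lemma sign_unit_ex k l : (k * l)%N = N -> coprime k l -> exists u, sign_unit k l u.
Proof.
move=> klN ckl; exists (chinese k l k.-1 1)%:R.
have kN : (k %| N)%N by rewrite -klN dvdn_mulr.
have lN : (l %| N)%N by rewrite -klN dvdn_mull.
have k0 : (0 < k)%N by apply: dvdn_gt0 kN; apply: modulus_gt0.
split.
  have -> : 1 + (chinese k l k.-1 1)%:R = (1 + chinese k l k.-1 1)%N%:R :> R.
    by rewrite natrD.
  rewrite dvd_Zp_nat // /dvdn -modnDmr (chinese_modl ckl) modnDmr.
  by rewrite add1n prednK // modnn.
have -> : (1 : R) = 1%N%:R by [].
by rewrite dvd_ZpB // !val_Zp_nat // !modn_dvdm // (chinese_modr ckl).
Qed.

Section SignUnit.
Variables (k l : nat) (u : R).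
Hypotheses (klN : (k * l)%N = N) (su : sign_unit k l u).

Let kN : (k %| N)%N. Proof. by rewrite -klN dvdn_mulr. Qed.
Let lN : (l %| N)%N. Proof. by rewrite -klN dvdn_mull. Qed.

Lemma sign_unit_sqr : u * u = 1.
Proof.
case: su => ku lu; apply/eqP; rewrite -subr_eq0.
have -> : u * u - 1 = (1 + u) * (u - 1) by ring.
by rewrite Zp_eq0_dvd dvd_ZpM //; have := dvdn_mul ku lu; rewrite klN.
Qed.

Lemma dvd_2_odd d : (d %| N)%N -> (d %| (2%:R : R))%N -> d = 1%N.
Proof.
move=> dN; rewrite dvd_Zp_nat // => d2.
have := dvdn_odd dN Nodd; have : (d <= 2)%N by apply: dvdn_leq.
by case: d d2 {dN} => [|[|[|]]].
Qed.

Lemma coprime_sign_l : coprime l (1 + u)%R.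
Proof.
case: su => _ lu; rewrite /coprime; apply/eqP.
set d := gcdn _ _; have dl : (d %| l)%N by rewrite dvdn_gcdl.
have dN := dvdn_trans dl lN; apply: dvd_2_odd => //.
have : (d %| (1 + u)%R)%N by rewrite dvdn_gcdr.
have -> : 1 + u = (u - 1) + 2%:R by ring.
by rewrite dvd_ZpD // dvdn_addr // (dvdn_trans dl).
Qed.

Lemma coprime_sign_k : coprime k (u - 1)%R.
Proof.
case: su => ku _; rewrite /coprime; apply/eqP.
set d := gcdn _ _; have dl : (d %| k)%N by rewrite dvdn_gcdl.
have dN := dvdn_trans dl kN; apply: dvd_2_odd => //.
have : (d %| (1 + u)%R)%N by rewrite (dvdn_trans dl).
have -> : 1 + u = (u - 1) + 2%:R by ring.
by rewrite dvd_ZpD // dvdn_addr // dvdn_gcdr.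
Qed.

Lemma sign_annihilator_l x : ((1 + u) * x == 0) = (l %| x)%N.
Proof. by case: su => ku _; apply: (annihilator_dvd _ klN ku coprime_sign_l). Qed.

Lemma sign_annihilator_k x : ((u - 1) * x == 0) = (k %| x)%N.
Proof.
by case: su => _ lu; apply: (annihilator_dvd _ _ lu coprime_sign_k); rewrite mulnC.
Qed.

End SignUnit.

Section TwoSigns.
Variables (k1 l1 k2 l2 : nat) (u v : R).
Hypotheses (kl1 : (k1 * l1)%N = N) (kl2 : (k2 * l2)%N = N).
Hypotheses (c1 : coprime k1 l1) (c2 : coprime k2 l2).
Hypotheses (su : sign_unit k1 l1 u) (sv : sign_unit k2 l2 v).

Lemma factors_gt0 : [/\ 0 < k1, 0 < l1, 0 < k2 & 0 < l2]%N.
Proof.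
by move: modulus_gt0; rewrite -{1}kl1 muln_gt0 => /andP[-> ->]; move: modulus_gt0;
  rewrite -{1}kl2 muln_gt0 => /andP[-> ->].
Qed.

Lemma card_fibre_diff : #|[set c : R | (1 + v) * c == 0]| = k2.
Proof.
have [_ _ _ l20] := factors_gt0.
rewrite -[RHS](mulnK _ l20) kl2 -(card_multiples (m := l2)); last first.
  by rewrite -kl2 dvdn_mull.
by apply: eq_card => x; rewrite !inE (sign_annihilator_l kl2 sv).
Qed.

(** The condition on d says that l2 divides (1 + u) d, and 1 + u is a unit at the
    primes of l1 and vanishes modulo k1. *)
Lemma card_shift_d :
  #|[set d : R | (1 + u) * (1 + v) * d == 0]| = (N %/ gcdn l1 l2)%N.
Proof.
have l2N : (l2 %| N)%N by rewrite -kl2 dvdn_mull.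
rewrite -(card_multiples (m := gcdn l1 l2)); last exact: dvdn_trans (dvdn_gcdr _ _) l2N.
apply: eq_card => x; rewrite !inE [(1 + u) * _]mulrC -mulrA.
rewrite (sign_annihilator_l kl2 sv) dvd_ZpM //; apply/idP/idP => [h|gx].
  rewrite -(Gauss_dvdr _ (m := gcdn l1 l2) (n := val (1 + u)%R)); last first.
    exact: coprime_dvdl (dvdn_gcdl _ _) (coprime_sign_l kl1 su).
  exact: dvdn_trans (dvdn_gcdr _ _) h.
have [ku _] := su; apply: (@dvdn_trans (gcdn k1 l2 * gcdn l1 l2)).
  by rewrite muln_gcdl !muln_gcdr !dvdn_gcd kl1 l2N dvdn_mull // !dvdn_mulr.
by rewrite dvdn_mul // (dvdn_trans (dvdn_gcdl _ _)).
Qed.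

(** The conditions on nu say that k1 and every prime of l1 divide nu. *)
Lemma card_nu :
  #|[set nu : R | (radical N %| nu)%N && ((u - 1) * nu == 0)]| =
  (l1 %/ radical l1)%N.
Proof.
have [k10 l10 _ _] := factors_gt0; have r0 := radical_gt0 l10.
have rl := radical_dvd l10.
have -> : (l1 %/ radical l1 = N %/ (k1 * radical l1))%N by rewrite -kl1 divnMl.
rewrite -(card_multiples (m := k1 * radical l1)); last by rewrite -kl1 dvdn_pmul2l.
apply: eq_card => x; rewrite !inE (sign_annihilator_k kl1 su).
rewrite Gauss_dvd; last exact: coprime_dvdr rl c1.
rewrite andbC; case: (boolP (k1 %| x)%N) => //= kx.
apply/(radical_dvdP _ modulus_gt0)/(radical_dvdP _ l10) => h p pp.
  by move=> pl; apply: h => //; rewrite -kl1 dvdn_mull.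
move=> pN; have : (p %| k1 * l1)%N by rewrite kl1.
rewrite Euclid_dvdM // => /orP[pk|]; last exact: h.
exact: dvdn_trans pk kx.
Qed.

(** At each prime p of k2 such a g is 1 or -1; this choice of signs determines g
    modulo the radical, hence g, as g + g' is a unit if g and g' agree there.
    All choices occur by the Chinese remainder theorem. *)
Lemma card_gamma :
  #|[set g : R | (g * g == 1) && ((1 + v) * (g - u) == 0)]| =
  (2 ^ size (primes k2))%N.
Proof.
have [k10 l10 k20 l20] := factors_gt0.
have k2N : (k2 %| N)%N by rewrite -kl2 dvdn_mulr.
have l2N : (l2 %| N)%N by rewrite -kl2 dvdn_mull.
have uu := sign_unit_sqr kl1 su.
set G := [set g : R | _]; set s := size _.
have GP g : reflect (g * g = 1 /\ (l2 %| (g - u)%R)%N) (g \in G).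
  rewrite inE (sign_annihilator_l kl2 sv).
  by apply: (iffP andP) => -[/eqP gg lg].
pose pr (i : 'I_s) := nth 0%N (primes k2) i.
have prP i : prime (pr i) /\ (pr i %| k2)%N.
  have := mem_nth 0%N (ltn_ord i); rewrite -/(pr i) mem_primes.
  by case/and3P.
pose f (g : R) : {ffun 'I_s -> bool} := [ffun i => (pr i %| (g - 1)%R)%N].
have pm1 g p : g \in G -> prime p -> (p %| N)%N -> ~~ (p %| (g - 1)%R)%N ->
    (p %| (g + 1)%R)%N.
  case/GP=> gg _ pp pN npg.
  have : (p %| ((g - 1) * (g + 1))%R)%N.
    have -> : (g - 1) * (g + 1) = g * g - 1 by ring.
    by rewrite gg subrr dvdn0.
  by rewrite dvd_ZpM // Euclid_dvdM // (negPf npg).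
rewrite -[RHS]/(2 ^ s)%N -[2%N]card_bool -[s in RHS]card_ord -card_ffun.
rewrite -(card_in_imset (f := f)); last first.
  move=> g h gG hG fgh; have [gg gu] := GP g gG; have [hh hu] := GP h hG.
  have rad : in_radical (g - h).
    move=> p pp pN; move: (pN); rewrite -{1}kl2 Euclid_dvdM // => /orP[pk|pl].
      have pin : p \in primes k2 by rewrite mem_primes pp k20.
      pose i : 'I_s := Ordinal (etrans (index_mem p (primes k2)) pin).
      have pi : pr i = p by rewrite /pr nth_index.
      have := congr1 (fun F : {ffun 'I_s -> bool} => F i) fgh; rewrite !ffunE pi.
      have [pg /esym ph|pg /esym/negbT ph] := boolP (p %| (g - 1)%R)%N.
        have /dvd_ZpB e := pN; move: pg ph; rewrite !e => /eqP pg /eqP ph.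
        by rewrite pg ph.
      have := pm1 _ _ gG pp pN pg; have := pm1 _ _ hG pp pN ph.
      have -> : h + 1 = h - (-1) by ring.
      have -> : g + 1 = g - (-1) by ring.
      have /dvd_ZpB e := pN; rewrite !e => /eqP ph' /eqP pg'.
      by rewrite pg' ph'.
    have /dvd_ZpB e := pN; rewrite e.
    have /dvd_ZpB e2 := l2N; move: gu hu; rewrite !e2 => /eqP gu /eqP hu.
    by rewrite -(modn_dvdm _ pl) gu -hu modn_dvdm.
  have ugh : g + h \is a GRing.unit.
    have -> : g + h = 2%:R * g + (g - h) * (-1) by ring.
    apply: unit_radical => //; last exact: in_radicalM.
    by rewrite unitrM two_unit //; apply/unitrP; exists g.
  apply/eqP; rewrite -subr_eq0; apply/eqP; apply: (mulIr ugh); rewrite mul0r.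
  by transitivity (g * g - h * h); [ring | rewrite gg hh subrr].
apply: eq_card => F; rewrite [RHS]inE; apply/imsetP.
pose pi : nat_pred := [pred p | [exists i, (pr i == p) && F i]].
pose m1 := (k2`_pi)%N; pose m2 := (k2`_pi^')%N.
have m12 : (m1 * m2)%N = k2 by apply: partnC.
have cm : coprime m1 m2 by apply: coprime_partC.
pose y := chinese m1 m2 1 m2.-1; pose x := chinese k2 l2 y u.
have m1k : (m1 %| k2)%N by rewrite -m12 dvdn_mulr.
have m2k : (m2 %| k2)%N by rewrite -m12 dvdn_mull.
have m20 : (0 < m2)%N by apply: dvdn_gt0 m2k.
have m1N := dvdn_trans m1k k2N; have m2N := dvdn_trans m2k k2N.
pose g : R := x%:R.
have gm1 : (m1 %| (g - 1)%R)%N.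
  have -> : (1 : R) = 1%N%:R by [].
  rewrite dvd_ZpB // !val_Zp_nat // !modn_dvdm //.
  by rewrite -(modn_dvdm _ m1k) (chinese_modl c2) modn_dvdm // (chinese_modl cm).
have gm2 : (m2 %| (g + 1)%R)%N.
  have -> : g + 1 = (1 + x)%N%:R by rewrite natrD addrC.
  rewrite dvd_Zp_nat // /dvdn -modnDmr.
  rewrite -(modn_dvdm x m2k) (chinese_modl c2) modn_dvdm // (chinese_modr cm).
  by rewrite modnDmr add1n prednK // modnn.
have gl2 : (l2 %| (g - u)%R)%N.
  by rewrite dvd_ZpB // val_Zp_nat // modn_dvdm // (chinese_modr c2).
have gG : g \in G.
  apply/GP; split=> //; apply/eqP; rewrite -subr_eq0 Zp_eq0_dvd.
  suff : (k2 * l2 %| (g * g - 1)%R)%N by rewrite kl2.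
  rewrite Gauss_dvd //; apply/andP; split.
    have -> : g * g - 1 = (g - 1) * (g + 1) by ring.
    by rewrite dvd_ZpM //; have := dvdn_mul gm1 gm2; rewrite m12.
  have -> : g * g - 1 = (g - u) * (g + u) by rewrite -uu; ring.
  by rewrite dvd_ZpM // dvdn_mulr.
exists g => //; apply/ffunP=> i; rewrite ffunE; have [pp pk] := prP i.
have pN := dvdn_trans pk k2N.
have pr_inj j : pr j = pr i -> j = i.
  move=> e; apply: val_inj; apply/eqP.
  by rewrite -(nth_uniq 0%N (ltn_ord j) (ltn_ord i) (primes_uniq k2)); apply/eqP.
have piE : (pr i \in pi) = F i.
  rewrite inE; apply/existsP/idP => [[j /andP[/eqP/pr_inj-> //]]|Fi].
  by exists i; rewrite eqxx.
have pi_dvd (rho : nat_pred) : pr i \in rho -> (pr i %| k2`_rho)%N.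
  move=> ir; rewrite -[pr i](part_pnat_id (pi := rho)) ?partn_dvd //.
  by rewrite pnatE.
case: (boolP (F i)) => Fi.
  by rewrite (dvdn_trans _ gm1) // pi_dvd // piE.
apply/esym/negbTE/negP => pg1.
have pg2 : (pr i %| (g + 1)%R)%N by rewrite (dvdn_trans _ gm2) // pi_dvd // inE /= piE.
have : pr i = 1%N.
  apply: dvd_2_odd => //; have : (pr i %| ((g - 1) + 2%:R)%R)%N.
    by have -> : (g - 1) + 2%:R = g + 1 by ring.
  by rewrite dvd_ZpD // dvdn_addr.
by move=> p1; rewrite p1 in pp.
Qed.

End TwoSigns.
End Counting.

(** * The number of conjugates of L_v normalised by L_u *)

Section CountFrames.
Variable N : nat.
Hypotheses (N1 : (1 < N)%N) (Nodd : odd N).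
Local Notation R := 'Z_N.
Local Notation E := ('Z_N * bool)%type.
Variables (u v : R).
Hypotheses (uu : u * u = 1) (vv : v * v = 1).
Local Notation Lu := (dihedral_gp uu).
Local Notation Lv := (dihedral_gp vv).

Lemma ffun_perm_inj (T : finType) : injective (fun q : {perm T} => [ffun x => q x]).
Proof.
by move=> p q /ffunP pq; apply/permP=> x; have := pq x; rewrite !ffunE.
Qed.

Let units : {set R} := [set c | c \is a GRing.unit].

Lemma card_norm_stab :
  #|[set q in 'N(Lv)%g | q origin == origin]| =
  (#|units| * #|[set c : R | ((1 + v) * c == 0)%R]|)%N.
Proof.
set K := [set c | _]; rewrite -cardsX -(card_imset _ (@ffun_perm_inj E)).
pose f (t : R * R) : {ffun E -> E} :=
  [ffun e => (t.1 * e.1 + (if e.2 then t.2 else 0), e.2)].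
have f_inj : injective f.
  move=> [a c] [a' c'] /ffunP eqf.
  have := eqf (0, true); rewrite !ffunE /= !mulr0 !add0r => /pair_equal_spec[-> _].
  have := eqf (1, false); rewrite !ffunE /= !addr0 !mulr1.
  by case/pair_equal_spec=> ->.
rewrite -(card_imset _ f_inj); apply: eq_card => F.
apply/imsetP/imsetP => [[q /setIdP[/(norm_dihedralP N1 Nodd)]]|].
  case=> [a [c [s [ua vc aq]]]] /eqP q0 ->.
  have := aq origin; rewrite q0 /= mulr0 add0r addbF => /pair_equal_spec[c0 s0].
  rewrite -c0 subr0 in vc.
  exists (a, c true); first by rewrite in_setX !in_set /= ua vc eqxx.
  apply/ffunP=> e; rewrite !ffunE aq -s0 /=.
  by case: e.2; rewrite // -c0.
case=> -[a c]; rewrite in_setX !in_set => /andP[/= ua /eqP vc] ->.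
have f_inj' : injective (f (a, c)).
  move=> [x s] [y t]; rewrite !ffunE /= => /pair_equal_spec[+ st]; rewrite st.
  by move/addIr/(mulrI ua)->.
exists (perm f_inj'); last by apply/ffunP=> e; rewrite [RHS]ffunE permE.
apply/setIdP; split; last by rewrite permE ffunE /= mulr0 addr0.
apply/(norm_dihedralP N1 Nodd); exists a, (fun t => if t then c else 0), false.
by split=> //; [rewrite /= subr0 | move=> e; rewrite permE ffunE].
Qed.

Lemma card_frames :
  #|[set q : {perm E} | (q origin == origin) && (Lu :^ q \subset 'N(Lv))%g]| =
  (#|[set nu : R | (radical N %| nu)%N && ((u - 1) * nu == 0)%R]| * #|units| *
   #|[set g : R | ((g * g == 1) && ((1 + v) * (g - u) == 0))%R]| *
   #|[set d : R | ((1 + u) * (1 + v) * d == 0)%R]|)%N.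
Proof.
set A := [set nu : R | _]; set G := [set g : R | _ && (_ * (_ - u) == _)]; set D := [set d : R | _].
rewrite -!cardsX -(card_imset _ (@ffun_perm_inj E)).
pose f (t : R * R * R * R) : {ffun E -> E} :=
  [ffun e => frame_fun u t.1.1.1 t.1.1.2 t.1.2 t.2 e].
have paramP nu c g d :
    reflect (frame_param u v nu c g d) ((nu, c, g, d) \in setX (setX (setX A units) G) D).
  rewrite !in_setX !in_set /=; apply: (iffP idP).
    case/andP=> /andP[/andP[/andP[rn /eqP un] uc] /andP[/eqP gg /eqP gv]] /eqP dv.
    by split=> //; split=> //; apply/(radical_dvdP _ (modulus_gt0 N1)).
  move=> [[rn un] uc [gg gv] dv].
  by rewrite uc un gg gv dv !eqxx !andbT; apply/(radical_dvdP _ (modulus_gt0 N1)).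
have f_inj : {in setX (setX (setX A units) G) D &, injective f}.
  move=> [[[nu c] g] d] [[[nu' c'] g'] d'] /paramP P /paramP P' /ffunP eqf.
  apply: (frame_param_inj N1 Nodd uu P P') => e.
  by have := eqf e; rewrite !ffunE.
rewrite -(card_in_imset f_inj); apply: eq_card => F.
apply/imsetP/imsetP => [[q]|].
  rewrite in_set => /andP[/eqP q0 Nq] ->.
  have [nu [c [g [d [P qE]]]]] := frame_exists N1 Nodd q0 Nq.
  by exists (nu, c, g, d); [exact/paramP | apply/ffunP=> e; rewrite !ffunE qE].
case=> [[[[nu c] g] d]] /paramP P ->.
pose q := perm (frame_fun_inj N1 Nodd uu P).
have qE : q =1 frame_fun u nu c g d by move=> e; rewrite permE.
have [q0 Nq] := frame_fun_norm N1 Nodd uu vv P qE.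
exists q; first by rewrite in_set q0 eqxx.
by apply/ffunP=> e; rewrite !ffunE qE.
Qed.

End CountFrames.

(** The factor of both sides that counts the unit c, respectively the unit a, is
    cancelled. *)
Lemma num_regular_dihedral N k1 l1 k2 l2 (u v : 'Z_N)
    (uu : u * u = 1) (vv : v * v = 1) :
  (1 < N)%N -> odd N -> (k1 * l1)%N = N -> (k2 * l2)%N = N ->
  coprime k1 l1 -> coprime k2 l2 -> sign_unit k1 l1 u -> sign_unit k2 l2 v ->
  (num_regular (dihedral_gp uu) (dihedral_gp vv) * k2 =
   l1 %/ radical l1 * 2 ^ size (primes k2) * (N %/ gcdn l1 l2))%N.
Proof.
move=> N1 Nodd kl1 kl2 c1 c2 su sv.
have := num_regular_normalizer origin (dihedral_gp uu) (dihedral_regular vv).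
rewrite card_norm_stab // card_frames // (card_nu N1 Nodd kl1 kl2 c1 su).
rewrite (card_gamma N1 Nodd kl1 kl2 c2 su sv).
rewrite (card_shift_d N1 Nodd kl1 kl2 su sv) (card_fibre_diff N1 Nodd kl1 kl2 sv).
set U := #|_| => e; have U0 : (0 < U)%N.
  by apply/card_gt0P; exists 1; rewrite in_set unitr1.
by apply/eqP; rewrite -(eqn_pmul2l U0) mulnCA e; apply/eqP; ring.
Qed.

(** * The groups D_(2k) x C_l *)

Section DihedralPresentation.
Local Open Scope group_scope.

(** The presentation could collapse; a group of order 2k satisfying it shows that
    it does not.  The case k = 1 is separate because 'Z_1 is Z/2. *)
Lemma dihedral_model k : odd k -> exists (rT : finGroupType) (H : {group rT}),
  #|H| = k.*2 /\ (H \homg Grp (r : s : r ^+ k, s ^+ 2, s * r * s = r^-1)).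
Proof.
move=> oddk; have [k1|k1] := leqP k 1.
  have -> : k = 1%N by case: k oddk k1 => [|[]].
  exists _, [set: 'I_2]%G; split; first by rewrite cardsT card_ord.
  apply/existsP; exists (1, Zp1) => /=; rewrite !xpair_eqE /=.
  apply/andP; split; last exact/eqP/val_inj.
  by rewrite cycle1 joing1G Zp_cycle.
have uu : (-1 * -1 = 1 :> 'Z_k)%R by rewrite mulrN1 opprK.
exists _, (dihedral_gp uu); split.
  by rewrite (regular_card (dihedral_regular uu) origin) card_two_fibres.
apply/existsP; exists (shift uu, flip uu) => /=; rewrite !xpair_eqE /=.
apply/andP; split.
  rewrite -[dihedral_set _]/(gval (dihedral_gp uu)) eqEsubset.
  rewrite join_subG !cycle_subG !mem_dihedral_perm /=.
  apply: subset_trans (dihedral_gen uu) _; rewrite gen_subG subUset !sub1set.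
  by rewrite mem_gen ?inE ?cycle_id // mem_gen ?inE ?cycle_id ?orbT.
apply/and3P; split; first by rewrite shiftN.
  apply/eqP/permP=> -[x s]; rewrite permM !flipE perm1 /= negbK.
  by rewrite mulrA uu mul1r.
apply/eqP; apply: (mulIg (shift uu)); rewrite mulVg.
apply/permP=> -[x s]; rewrite !permM flipE shiftE flipE shiftE perm1 /=.
by rewrite negbK; congr (_, _); ring.
Qed.

Lemma dihedral_pres_frame k gT (D : {group gT}) : odd k ->
  D \isog Grp (r : s : r ^+ k, s ^+ 2, s * r * s = r^-1) ->
  exists r s, [/\ D :=: <[r]> <*> <[s]>, #[r] = k, #|D| = k.*2,
                  s ^+ 2 = 1 & r ^ s = r^-1].
Proof.
move=> oddk isoD; have /existsP[[r s] /=] := isoGrp_hom isoD.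
case/eqP=> defD rk s2 srs; exists r, s.
have rs : r ^ s = r^-1.
  rewrite -srs /conjg mulgA; congr (_ * _ * _); apply/eqP.
  by rewrite eq_invg_mul -[s * s]/(s ^+ 2) s2.
have nrs : <[s]> \subset 'N(<[r]>) by rewrite norms_cycle rs groupV cycle_id.
have le_r : (#[r] <= k)%N by rewrite dvdn_leq ?odd_gt0 // order_dvdn rk.
have le_s : (#[s] <= 2)%N by rewrite dvdn_leq // order_dvdn s2.
have le_D : (#|D| <= #[r] * #[s])%N.
  by rewrite -defD norm_joinEr // /order mul_cardG leq_pmulr ?cardG_gt0.
have cardD : #|D| = k.*2.
  apply/eqP; rewrite eqn_leq; apply/andP; split.
    by rewrite -muln2 (leq_trans le_D) // leq_mul.
  have [rT [H [<- homH]]] := dihedral_model oddk.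
  by rewrite dvdn_leq ?cardG_gt0 // card_homg // isoD.
split=> //; apply/eqP; rewrite eqn_leq le_r /= -leq_double -cardD -muln2.
by rewrite (leq_trans le_D) // leq_mul.
Qed.

(** The product of the generators of the two cyclic factors generates the cyclic
    subgroup of order k l, by coprimality; the involution inverts its D-part and
    centralises its C-part. *)
Lemma Mgroup_frame k l gT (G : {group gT}) : odd (k * l)%N -> coprime k l ->
  is_Mgroup k l G ->
  #|G| = (k * l)%N.*2 /\
  exists rho sigma, [/\ G \subset <<[set rho; sigma]>>, rho \in G, sigma \in G,
     #[rho] = (k * l)%N & sigma ^+ 2 = 1 /\
     (forall w, (k %| w.+1)%N -> (w = 1 %[mod l])%N -> rho ^ sigma = rho ^+ w)].
Proof.
rewrite oddM => /andP[oddk oddl] ckl [D [C [defG isoD /cyclicP[c defC] cardC]]].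
have [r [s [defD or cardD s2 rs]]] := dihedral_pres_frame oddk isoD.
have [_ defDC cDC tiDC] := dprodP defG.
have oc : #[c] = l by rewrite -cardC defC.
have rD : r \in D by rewrite defD mem_gen // inE cycle_id.
have sD : s \in D by rewrite defD mem_gen // inE cycle_id orbT.
have cC : c \in C by rewrite defC cycle_id.
have crc : commute r c by apply: commute_sym; apply: (centsP cDC).
have csc : commute s c by apply: commute_sym; apply: (centsP cDC).
have corc : coprime #[r] #[c] by rewrite or oc.
have DG : D \subset G by rewrite -defDC mulG_subl.
have CG : C \subset G by rewrite -defDC mulG_subr.
split; first by rewrite -(dprod_card defG) cardD cardC -doubleMl.
exists (r * c), s; split.
- have rcE : <[r * c]> = <[r]> * <[c]> by apply: cycleM.
  have rho_sub : <[r * c]> \subset <<[set r * c; s]>>.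
    by rewrite cycle_subG mem_gen // !inE eqxx.
  rewrite -defDC; apply: mul_subG; last first.
    by rewrite defC (subset_trans _ rho_sub) // rcE mulG_subr.
  rewrite defD join_subG; apply/andP; split.
    by rewrite (subset_trans _ rho_sub) // rcE mulG_subl.
  by rewrite cycle_subG mem_gen // !inE eqxx orbT.
- by apply: groupM; [apply: (subsetP DG) | apply: (subsetP CG)].
- exact: (subsetP DG).
- by rewrite orderM // or oc.
split=> // w kw lw; rewrite conjMg rs expgMn //.
have -> : c ^ s = c by apply/conjg_fixP/commgP/commute_sym.
have -> : c ^+ w = c.
  by apply/eqP; rewrite -[X in _ == X]expg1 eq_expg_mod_order oc lw.
congr (_ * _); apply/eqP; rewrite eq_invg_mul -expgS.
by rewrite -order_dvdn or.
Qed.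

(** The permutation with parameters c and s, which is flip ^+ s * shift ^+ c, is
    sent to sigma ^+ s * rho ^+ c. *)
Lemma Mgroup_isog N k l gT (G : {group gT}) (w : 'Z_N) (ww : (w * w = 1)%R) :
  (k * l)%N = N -> (1 < N)%N -> odd N -> coprime k l -> sign_unit k l w ->
  is_Mgroup k l G -> G \isog dihedral_gp ww.
Proof.
move=> klN N1 Nodd ckl [kw lw] /(Mgroup_frame _ ckl); rewrite klN => /(_ Nodd).
case=> cardG [rho [sigma [genG rG sG ord_rho [s2 conj_rho]]]].
have rs : rho ^ sigma = rho ^+ w.
  have kN : (k %| N)%N by rewrite -klN dvdn_mulr.
  have lN : (l %| N)%N by rewrite -klN dvdn_mull.
  apply: conj_rho.
    by rewrite -add1n -(dvd_Zp_nat N1) // natrD natr_Zp.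
  have := lw; rewrite (dvd_ZpB N1) // => /eqP ->.
  have -> : nat_of_ord (1 : 'Z_N)%R = (1 %% N)%N by rewrite -val_Zp_nat.
  by rewrite modn_dvdm.
have rhoN : rho ^+ N = 1 by rewrite -ord_rho expg_order.
have rhoD (x y : 'Z_N) : rho ^+ (x + y)%R = rho ^+ x * rho ^+ y.
  have -> : nat_of_ord (x + y)%R = ((x + y) %% N)%N.
    by rewrite -val_Zp_nat // GRing.natrD !natr_Zp.
  by rewrite (expg_mod _ rhoN) expgD.
have rhoM (x y : 'Z_N) : rho ^+ (x * y)%R = (rho ^+ x) ^+ y.
  have -> : nat_of_ord (x * y)%R = ((x * y) %% N)%N.
    by rewrite -val_Zp_nat // GRing.natrM !natr_Zp.
  by rewrite (expg_mod _ rhoN) expgM.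
have sigmaD (s t : bool) : sigma ^+ (s (+) t) = sigma ^+ s * sigma ^+ t.
  by case: s; case: t; rewrite ?mulg1 ?mul1g // -[RHS]s2.
have rho_sigma (x : 'Z_N) (t : bool) :
    rho ^+ x * sigma ^+ t = sigma ^+ t * rho ^+ ((w ^+ t) * x)%R.
  case: t; last by rewrite !expg0 mulg1 mul1g GRing.expr0 mul1r.
  by rewrite expg1 conjgC conjXg rs GRing.expr1 rhoM.
pose phi (p : {perm 'Z_N * bool}) := sigma ^+ (p origin).2 * rho ^+ (p origin).1.
have phiE c s : phi (dihedral_perm ww c s) = sigma ^+ s * rho ^+ c.
  rewrite /phi; have -> : dihedral_perm ww c s origin = (c, s); last by [].
  by rewrite dihedral_permE /= mulr0 add0r addbF.
have phiM : {in dihedral_gp ww &, {morph phi : p q / p * q}}.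
  move=> _ _ /dihedral_gpP[c [s ->]] /dihedral_gpP[d [t ->]].
  rewrite dihedral_permM !phiE rhoD addbC sigmaD -!mulgA; congr (_ * _).
  by rewrite !mulgA rho_sigma.
pose f := Morphism phiM.
have sub_im : G \subset f @* dihedral_gp ww.
  apply: subset_trans genG _; rewrite gen_subG; apply/subsetP=> x /set2P[] ->.
    have -> : rho = f (dihedral_perm ww 1%R false).
      by rewrite /= phiE mul1g -[LHS]expg1 -[RHS](expg_mod _ rhoN) (modn_small N1).
    by rewrite mem_morphim ?mem_dihedral_perm.
  have -> : sigma = f (dihedral_perm ww 0%R true) by rewrite /= phiE mulg1.
  by rewrite mem_morphim ?mem_dihedral_perm.
have card_dih : #|dihedral_gp ww| = N.*2.
  by rewrite (regular_card (dihedral_regular ww) origin) card_two_fibres.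
have im_sub : f @* dihedral_gp ww \subset G.
  apply/subsetP=> _ /morphimP[p _ _ ->] /=.
  by rewrite /phi groupM ?groupX.
have imG : f @* dihedral_gp ww = G by apply/eqP; rewrite eqEsubset im_sub.
rewrite isog_sym; apply/isogP; exists f; last exact: imG.
by rewrite -card_im_injm imG cardG card_dih.
Qed.

End DihedralPresentation.

(** * The count of Hopf-Galois structures *)

(** For N = 1, where 'Z_N is not Z/N: the group of all permutations of two points
    is the only regular one. *)
Lemma e_number_order2 (gammaT gT : finGroupType) (G : {group gT}) :
  #|[set: gammaT]| = 2%N -> #|G| = 2%N -> e_number gammaT G = 1%N.
Proof.
move=> cardT cardG; have rL := left_mulV_regular gammaT.
set P := [set: {perm gammaT}]%G; have cardP : #|P| = 2%N.
  transitivity #|perm_on [set: gammaT]|; last by rewrite card_perm cardT.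
  by apply: eq_card => p; rewrite !inE; apply/esym/subsetP=> x _; rewrite inE.
have regP : regular_subgroup P.
  suff <- : (left_mulV_morphism gammaT @* [set: gammaT])%G = P by [].
  apply/val_inj/eqP; rewrite /= eqEcard subsetT /= cardP.
  by rewrite (card_injm (injm_left_mulV _)) // cardT.
rewrite /e_number -(cards1 P); apply: eq_card => M; rewrite !inE.
apply/idP/eqP => [/and3P[rM _ _]|->].
  apply/val_inj/eqP; rewrite /= eqEcard subsetT /= (regular_card rM 1%g).
  by rewrite -cardsT cardT cardP.
rewrite regP isog_cyclic_card ?prime_cyclic ?cardP ?cardG // andbT.
exact: subset_trans (subsetT _) (normG _).
Qed.

Theorem theorem1p3 (N k1 l1 k2 l2 : nat)
    (hN0 : (0 < N)%N) (hNodd : odd N) (hN : burnside_number (radical N))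
    (hk1 : (0 < k1)%N) (hl1 : (0 < l1)%N) (hk2 : (0 < k2)%N) (hl2 : (0 < l2)%N)
    (hkl1 : (k1 * l1)%N = N) (hkl2 : (k2 * l2)%N = N)
    (hc1 : coprime k1 l1) (hc2 : coprime k2 l2)
    (gammaT gT : finGroupType)
    (hGamma : is_Mgroup k1 l1 [set: gammaT]) (hG : is_Mgroup k2 l2 [set: gT])
    (F : fieldType) (L : splittingFieldType F)
    (hgal : galois 1 {:L})
    (hiso : ('Gal({:L} / 1) \isog [set: gammaT])%g) :
  num_hopf_galois_of_type L [set: gT] (e_number gammaT [set: gT]) /\
  (e_number gammaT [set: gT])%:R =
    (l1 * l2)%:R / (gcdn l1 l2 * radical l1)%:R * 2 ^+ size (primes k2) :> rat.
Proof.
split; first exact: num_hopf_galois_e_number.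
have g0 : (0 < gcdn l1 l2 * radical l1)%N.
  by rewrite muln_gt0 gcdn_gt0 hl1 radical_gt0.
suff e_eq : (e_number gammaT [set: gT] * (gcdn l1 l2 * radical l1) =
             l1 * l2 * 2 ^ size (primes k2))%N.
  rewrite mulrAC -natrX -natrM -e_eq natrM mulfK //.
  by rewrite Num.Theory.pnatr_eq0 -lt0n.
(* For N = 1 both groups have order 2. *)
have [N1|N1] := leqP N 1.
  have NE : N = 1%N by apply/eqP; rewrite eqn_leq N1.
  have factors1 k l : (k * l)%N = N -> k = 1%N /\ l = 1%N.
    by rewrite NE => /eqP; rewrite muln_eq1 => /andP[/eqP-> /eqP->].
  have [k1E l1E] := factors1 _ _ hkl1; have [k2E l2E] := factors1 _ _ hkl2.
  rewrite {}k1E {}l1E in hGamma *; rewrite {}k2E {}l2E in hG *.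
  have [cardGamma _] := @Mgroup_frame 1 1 _ [set: gammaT]%G isT isT hGamma.
  have [cardG _] := @Mgroup_frame 1 1 _ [set: gT]%G isT isT hG.
  by rewrite e_number_order2 // /radical big_nil.
have [u su] := sign_unit_ex N1 hkl1 hc1.
have [v sv] := sign_unit_ex N1 hkl2 hc2.
have uu := sign_unit_sqr N1 hkl1 su; have vv := sign_unit_sqr N1 hkl2 sv.
have isoGamma := Mgroup_isog (G := [set: gammaT]%G) uu hkl1 N1 hNodd hc1 su hGamma.
have isoG := Mgroup_isog (G := [set: gT]%G) vv hkl2 N1 hNodd hc2 sv hG.
rewrite isog_sym in isoGamma.
rewrite (e_numberE origin [set: gT]%G (dihedral_regular uu) isoGamma).
rewrite (num_regular_isogr _ isoG).
have := num_regular_dihedral uu vv N1 hNodd hkl1 hkl2 hc1 hc2 su sv.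
set e := num_regular _ _ => e_eq; apply/eqP; rewrite -(eqn_pmul2r hk2); apply/eqP.
have gN : (gcdn l1 l2 %| N)%N.
  by rewrite (dvdn_trans (dvdn_gcdr _ _)) // -hkl2 dvdn_mull.
rewrite mulnAC e_eq.
transitivity (l1 %/ radical l1 * radical l1 * 2 ^ size (primes k2) *
   (N %/ gcdn l1 l2 * gcdn l1 l2))%N; first by ring.
by rewrite (divnK (radical_dvd hl1)) (divnK gN) -hkl2; ring.
Qed.
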